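(* Let $F:\mathbb{R}^n\to\mathbb{R}^n$ be locally Lipschitz, $X^*=\{x:F(x)=0\}$, $\mathcal{M}$ a smooth embedded submanifold of $\mathbb{R}^n$, and $\tilde X^*=X^*\cap\mathcal{M}$. Let $q\in(1,2]$, $L_3>0$, and consider the projected semismooth Newton iteration started at $x_0\in\mathcal{M}$: $$(J_kP_k+\mu_kI)d_k=-F(x_k)+r_k,\qquad x_{k+1}=P_{\mathcal{M}}(x_k+d_k),$$ where $J_k\in\partial_BF(x_k)$, $P_k=P(x_k)$, $\mu_k=\|F(x_k)\|$, and $\|r_k\|/\mu_k\le L_3\|F(x_k)\|^q$. Let $x^*$ be a point of $\tilde X^*$ nearest to $x_0$, and suppose that (A1), (A2), (A3) below hold at $x^*$. If $x_0$ is chosen sufficiently close to $\tilde X^*$, then $\{x_k\}$ converges superlinearly to some solution $\hat x\in\tilde X^*$ of $F(x)=0$.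
   Context: $\partial_BF(x)=\{\lim_kJ(x^k):x^k\to x, F \text{ differentiable at } x^k\}$ (B-Jacobian). $P(x)$ is the matrix of the orthogonal projection onto the tangent space $T_x\mathcal{M}$; $P_{\mathcal{M}}$ is the metric projection onto $\mathcal{M}$. (A1) at $x^*$: there are $b_1>0$, $L_2>0$ such that $F$ is $L_2$-Lipschitz on $\bar B(x^*,b_1)$, and a constant $L_1>0$ such that $\|F(y)-F(x)-J(x)(y-x)\|\le L_1\|y-x\|^2$ for all $x,y\in\mathcal{M}\cap\bar B(x^*,b_1)$ and every $J(x)\in\partial_BF(x)$. (A2) at $x^*$: there is $b_2>0$ such that for all $x\in\mathcal{M}\cap\bar B(x^*,b_2)$ and all $J(x)\in\partial_BF(x)$, $\|(J(x)P(x)+\mu(x)I)^{-1}\|\le\mu(x)^{-1}$, where $\mu(x)=\|F(x)\|$. (A3) at $x^*$: there are $b_3>0$, $\gamma>0$ with $\|F(x)\|\ge\gamma\,\mathrm{dist}(x,\tilde X^* )$ for all $x\in\mathcal{M}\cap\bar B(x^*,b_3)$. Superlinear convergence here means $\|x_{k+1}-\hat x\|=o(\|x_k-\hat x\|)$. *)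

(* Defs.v *)
From HB Require Import structures.
From mathcomp Require Import all_boot all_order all_algebra.
From mathcomp Require Import all_classical all_reals all_analysis.
Set Implicit Arguments. Unset Strict Implicit. Unset Printing Implicit Defensive.
Import Order.TTheory GRing.Theory Num.Theory.
Import numFieldNormedType.Exports.
Local Open Scope classical_set_scope.
Local Open Scope ring_scope.

Section Defs.
Variable R : realType.

Definition enorm n (v : 'rV[R]_n) : R := Num.sqrt (\sum_(i < n) v ord0 i ^+ 2).

Definition edot n (u v : 'rV[R]_n) : R := \sum_(i < n) u ord0 i * v ord0 i.

(* Action of a (standard, column-convention) matrix A on the vector v:
   in column notation this is A v; with row vectors it is v A^T. *)
Definition app n (A : 'M[R]_n) (v : 'rV[R]_n) : 'rV[R]_n := v *m A^T.

Definition edist n (x : 'rV[R]_n) (S : set 'rV[R]_n) : R :=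
  inf [set enorm (x - y) | y in S].

Definition cball n (c : 'rV[R]_n) (r : R) : set 'rV[R]_n :=
  [set y | enorm (y - c) <= r].

Definition iter_dder n p (vs : seq 'rV[R]_n) (g : 'rV[R]_n -> 'rV[R]_p) :=
  foldr (fun v h => 'D_v h) g vs.

Definition smooth_on n p (U : set 'rV[R]_n) (g : 'rV[R]_n -> 'rV[R]_p) :=
  forall vs : seq 'rV[R]_n,
    (forall x, U x -> {for x, continuous (iter_dder vs g)}) /\
    (forall x v, U x -> derivable (iter_dder vs g) x v).

Definition embedded_submanifold n (M : set 'rV[R]_n) :=
  exists m : nat, (m <= n)%N /\
  forall p, M p -> exists (U : set 'rV[R]_n) (g : 'rV[R]_n -> 'rV[R]_(n - m)),
    [/\ open U, U p, smooth_on U g,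
        (forall x, U x -> M x -> forall w, exists v, 'D_v g x = w) &
        (forall x, U x -> (M x <-> g x = 0))].

Definition tangent_space n (M : set 'rV[R]_n) (x : 'rV[R]_n) : set 'rV[R]_n :=
  [set v | exists gam : R -> 'rV[R]_n,
     [/\ gam 0 = x, \forall t \near (0 : R), M (gam t) & is_derive (0 : R) 1 gam v]].

Definition is_tangent_proj n (M : set 'rV[R]_n) (x : 'rV[R]_n) (Pm : 'M[R]_n) :=
  forall v, tangent_space M x (app Pm v) /\
            (forall w, tangent_space M x w -> edot (v - app Pm v) w = 0).

Definition nearest_point n (S : set 'rV[R]_n) (z y : 'rV[R]_n) :=
  S y /\ forall w, S w -> enorm (z - y) <= enorm (z - w).

(* Standard (column-convention) Jacobian matrix of F at x. *)
Definition jac n (F : 'rV[R]_n -> 'rV[R]_n) (x : 'rV[R]_n) : 'M[R]_n :=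
  ('J F x)^T.

Definition B_jacobian n (F : 'rV[R]_n -> 'rV[R]_n) (x : 'rV[R]_n) : set 'M[R]_n :=
  [set J | exists xs : nat -> 'rV[R]_n,
     [/\ xs @ \oo --> x, (forall k, differentiable F (xs k)) &
         (fun k => jac F (xs k)) @ \oo --> J]].

Definition locally_lipschitz n (F : 'rV[R]_n -> 'rV[R]_n) :=
  forall x, exists r L : R, 0 < r /\ forall y z,
    enorm (y - x) < r -> enorm (z - x) < r -> enorm (F y - F z) <= L * enorm (y - z).

Definition assumption_A1 n (F : 'rV[R]_n -> 'rV[R]_n) (M : set 'rV[R]_n) xs :=
  exists b1 L2 L1 : R, [/\ 0 < b1, 0 < L2, 0 < L1,
    (forall x y, cball xs b1 x -> cball xs b1 y ->
       enorm (F y - F x) <= L2 * enorm (y - x)) &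
    (forall x y J, M x -> cball xs b1 x -> M y -> cball xs b1 y ->
       B_jacobian F x J ->
       enorm (F y - F x - app J (y - x)) <= L1 * enorm (y - x) ^+ 2)].

(* (A2) at xs (for points that are not zeros of F, where mu(x) > 0). *)
Definition assumption_A2 n (F : 'rV[R]_n -> 'rV[R]_n) (M : set 'rV[R]_n)
    (P : 'rV[R]_n -> 'M[R]_n) xs :=
  exists b2 : R, 0 < b2 /\
    forall x J, M x -> cball xs b2 x -> F x != 0 -> B_jacobian F x J ->
      let A := J *m P x + (enorm (F x))%:M in
      A \in unitmx /\
      forall v, enorm (app (invmx A) v) <= (enorm (F x))^-1 * enorm v.

Definition assumption_A3 n (F : 'rV[R]_n -> 'rV[R]_n) (M : set 'rV[R]_n) xs :=
  exists b3 gam : R, [/\ 0 < b3, 0 < gam &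
    forall x, M x -> cball xs b3 x ->
      enorm (F x) >= gam * edist x [set y | F y = 0 /\ M y]].

End Defs.

(* Main.v *)
Require Import Defs.
From HB Require Import structures.
From mathcomp Require Import all_boot all_order all_algebra.
From mathcomp Require Import all_classical all_reals all_analysis.
From mathcomp Require Import ring lra.
Import Order.TTheory GRing.Theory Num.Theory.
Import numFieldNormedType.Exports.
Local Open Scope classical_set_scope.
Local Open Scope ring_scope.
Set Implicit Arguments.
Unset Strict Implicit.
Unset Printing Implicit Defensive.

(** Write mu_k = ||F(x_k)||. The error bound puts a solution y with
    ||y - x_k|| = O(mu_k). Since y - x_k is tangent to M up to second order, (A1)
    gives (J P + mu I)(d_k - (y - x_k)) = O(mu_k^2), and (A2) then yields
    ||d_k|| = O(mu_k). That bound is only linear; the gain comes from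
    F(x_k) + J P d_k = r_k - mu_k d_k = O(mu_k^2) together with
    x_{k+1} = x_k + P d_k + O(||d_k||^2), which give mu_{k+1} = O(mu_k^2). Hence the
    steps, being O(mu_k), are summable, the limit xhat is a solution,
    ||x_k - xhat|| = O(mu_k) <= O(||x_k - xhat||), and the convergence is quadratic.

    The two facts about M (chords are tangent, and the normal space moves, up to
    O(distance)) come from a local equation g = 0 of M: the distance of v to the
    tangent space at x is at most a constant times ||Dg(x) v||. *)

(** * Euclidean norm *)

Section EuclideanNorm.
Variable R : realType.

Lemma edotC n (u v : 'rV[R]_n) : edot u v = edot v u.
Proof. by apply: eq_bigr => i _; rewrite mulrC. Qed.

Lemma edotDl n (u v w : 'rV[R]_n) : edot (u + v) w = edot u w + edot v w.
Proof. by rewrite /edot -big_split; apply: eq_bigr => i _; rewrite mxE mulrDl. Qed.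

Lemma edotZl n a (u w : 'rV[R]_n) : edot (a *: u) w = a * edot u w.
Proof. by rewrite /edot mulr_sumr; apply: eq_bigr => i _; rewrite mxE mulrA. Qed.

Lemma edotNl n (u w : 'rV[R]_n) : edot (- u) w = - edot u w.
Proof. by rewrite -scaleN1r edotZl mulN1r. Qed.

Lemma edotDr n (u v w : 'rV[R]_n) : edot w (u + v) = edot w u + edot w v.
Proof. by rewrite edotC edotDl !(edotC w). Qed.

Lemma edotZr n a (u w : 'rV[R]_n) : edot w (a *: u) = a * edot w u.
Proof. by rewrite edotC edotZl (edotC w). Qed.

Lemma edotNr n (u w : 'rV[R]_n) : edot w (- u) = - edot w u.
Proof. by rewrite edotC edotNl (edotC w). Qed.

Lemma edotvv_ge0 n (v : 'rV[R]_n) : 0 <= edot v v.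
Proof. by apply: sumr_ge0 => i _; rewrite -expr2 sqr_ge0. Qed.

Lemma enorm_sqr n (v : 'rV[R]_n) : enorm v ^+ 2 = edot v v.
Proof.
rewrite /enorm sqr_sqrtr; last by apply: sumr_ge0 => i _; exact: sqr_ge0.
by apply: eq_bigr => i _; rewrite expr2.
Qed.

Lemma enorm_ge0 n (v : 'rV[R]_n) : 0 <= enorm v.
Proof. exact: sqrtr_ge0. Qed.
Hint Resolve enorm_ge0 : core.

Lemma enorm0 n : enorm (0 : 'rV[R]_n) = 0.
Proof. by rewrite /enorm big1 ?sqrtr0// => i _; rewrite mxE expr0n. Qed.

Lemma normr_coord_le n (v : 'rV[R]_n) i : `|v ord0 i| <= enorm v.
Proof.
rewrite -sqrtr_sqr ler_sqrt; last by apply: sumr_ge0 => j _; exact: sqr_ge0.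
by rewrite (bigD1 i)//= lerDl; apply: sumr_ge0 => j _; exact: sqr_ge0.
Qed.

Lemma enorm_eq0 n (v : 'rV[R]_n) : enorm v = 0 -> v = 0.
Proof.
move=> v0; apply/rowP => i; rewrite mxE; apply/eqP; rewrite -normr_eq0.
by apply/eqP/le_anti; rewrite normr_ge0 -v0 normr_coord_le.
Qed.

Lemma enorm_gt0 n (v : 'rV[R]_n) : v != 0 -> 0 < enorm v.
Proof. by move=> v0; rewrite lt0r enorm_ge0 andbT; apply: contra v0 => /eqP/enorm_eq0 ->. Qed.

(** Cauchy-Schwarz, by expanding the square of |v| u - |u| v and dividing by |u| |v|. *)
Lemma edot_le n (u v : 'rV[R]_n) : edot u v <= enorm u * enorm v.
Proof.
have [->|v0] := eqVneq v 0.
  by rewrite enorm0 mulr0 /edot big1// => i _; rewrite mxE mulr0.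
have ev := enorm_gt0 v0.
have := edotvv_ge0 (enorm v *: u - enorm u *: v).
rewrite edotDl !edotDr !(edotNl, edotNr, edotZl, edotZr) -!enorm_sqr (edotC v u).
set a := enorm u; set b := enorm v; set c := edot u v => H.
have [a0|] := ltP 0 a; last first.
  move=> a0; have /enorm_eq0 u0 : enorm u = 0 by apply/le_anti; rewrite a0 enorm_ge0.
  by rewrite /c /a u0 enorm0 mul0r /edot big1// => i _; rewrite mxE mul0r.
have ab : 0 < a * b by rewrite mulr_gt0.
by rewrite -(ler_pM2l ab); nra.
Qed.

Lemma enormN n (v : 'rV[R]_n) : enorm (- v) = enorm v.
Proof. by congr Num.sqrt; apply: eq_bigr => i _; rewrite mxE sqrrN. Qed.

Lemma enormB n (u v : 'rV[R]_n) : enorm (u - v) = enorm (v - u).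
Proof. by rewrite -enormN opprB. Qed.

Lemma enormZ n a (v : 'rV[R]_n) : enorm (a *: v) = `|a| * enorm v.
Proof.
rewrite /enorm -(sqrtr_sqr a) -sqrtrM ?sqr_ge0//; congr Num.sqrt.
by rewrite mulr_sumr; apply: eq_bigr => i _; rewrite mxE exprMn.
Qed.

Lemma enormD n (u v : 'rV[R]_n) : enorm (u + v) <= enorm u + enorm v.
Proof.
rewrite -(ler_pXn2r (_ : 0 < 2)%N) ?nnegrE ?addr_ge0// enorm_sqr.
rewrite edotDl !edotDr -!enorm_sqr (edotC v u).
by have := edot_le u v; lra.
Qed.

Lemma enormB_sqr n (u v : 'rV[R]_n) :
  enorm (u - v) ^+ 2 = enorm u ^+ 2 - 2 * edot u v + enorm v ^+ 2.
Proof.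
by rewrite !enorm_sqr edotDl !edotDr edotNl !edotNr edotNl (edotC v u); ring.
Qed.

Lemma enorm_sub n (u v : 'rV[R]_n) : enorm u <= enorm v + enorm (u - v).
Proof. by rewrite -{1}(subrK v u) addrC; exact: enormD. Qed.

Lemma enorm_triangle n (u v w : 'rV[R]_n) :
  enorm (u - w) <= enorm (u - v) + enorm (v - w).
Proof. by rewrite -(subrKA v u); exact: enormD. Qed.

Lemma enorm_sum n (I : Type) (s : seq I) (f : I -> 'rV[R]_n) :
  enorm (\sum_(i <- s) f i) <= \sum_(i <- s) enorm (f i).
Proof.
elim/big_rec2 : _ => [|i y x _ h]; first by rewrite enorm0.
by rewrite (le_trans (enormD _ _))// lerD2l.
Qed.

Lemma enorm_le_coord n c (v : 'rV[R]_n) :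
  (forall i, `|v ord0 i| <= c) -> enorm v <= n%:R * c.
Proof.
move=> vc; rewrite (row_sum_delta v) (le_trans (enorm_sum _ _))//.
rewrite -[leRHS]/(n%:R * c) mulr_natl -[n in c *+ n]card_ord -sumr_const.
apply: ler_sum => i _; rewrite enormZ.
suff -> : enorm (delta_mx 0 i : 'rV[R]_n) = 1 by rewrite mulr1.
rewrite /enorm (bigD1 i)//= mxE !eqxx expr1n big1 ?addr0 ?sqrtr1// => j ji.
by rewrite mxE (negbTE ji) andbF expr0n.
Qed.

(** The topology on row vectors comes from the max norm [|v|]. This bound and the next carry limits
    between that norm and the Euclidean one. *)
Lemma normr_le_enorm n (v : 'rV[R]_n) : `|v| <= enorm v.
Proof.
rewrite [leLHS]/Num.Def.normr/= mx_normrE bigmax_le// => -[i j] _ /=.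
by rewrite (ord1 i) normr_coord_le.
Qed.

Lemma enorm_le_normr n (v : 'rV[R]_n) : enorm v <= n%:R * `|v|.
Proof.
apply: enorm_le_coord => i.
by rewrite [leRHS]/Num.Def.normr/= mx_normrE (le_bigmax _ _ (ord0, i)).
Qed.

Lemma mulmx_bounded m p (B : 'M[R]_(m, p)) :
  exists2 C, 0 < C & forall w : 'rV_m, enorm (w *m B) <= C * enorm w.
Proof.
exists (1 + \sum_i enorm (row i B)) => [|w].
  by rewrite ltr_pwDl// sumr_ge0.
rewrite mulmx_sum_row (le_trans (enorm_sum _ _))// mulrDl mul1r mulr_suml.
rewrite ler_wpDl// ler_sum// => i _.
by rewrite enormZ mulrC ler_wpM2l// normr_coord_le.
Qed.

Lemma nbhs_enorm n (x : 'rV[R]_n) (A : set 'rV[R]_n) : nbhs x A ->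
  exists2 e : R, 0 < e & forall y, enorm (y - x) < e -> A y.
Proof.
move=> /nbhs_ballP[e /= e0 xA]; exists e => // y yx; apply: xA.
by rewrite -ball_normE /= distrC (le_lt_trans (normr_le_enorm _)).
Qed.

Lemma cvg_enorm_lt n (T : Type) (D : set_system T) {DF : Filter D}
    (f : T -> 'rV[R]_n) (y : 'rV[R]_n) (e : R) :
  f @ D --> y -> 0 < e -> \forall t \near D, enorm (f t - y) < e.
Proof.
move=> fy e0.
have n1 : 0 < n%:R + 1 :> R by rewrite ltr_wpDl.
move/cvgrPdist_lt : fy => /(_ (e / (n%:R + 1)) (divr_gt0 e0 n1)).
apply: filterS => t; rewrite distrC => h.
rewrite (le_lt_trans (enorm_le_normr _))//.
move: h; rewrite ltr_pdivlMr// => h; rewrite (le_lt_trans _ h)// mulrC.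
by rewrite ler_wpM2l// lerDl.
Qed.

(** * Sequences with geometrically decreasing steps *)

Lemma geometric_small (c e : R) : 0 <= c -> 0 < e ->
  exists k0, forall k, (k0 <= k)%N -> c * 2^-1 ^+ k < e.
Proof.
move=> c0 e0.
have : (c * 2^-1 ^+ k) @[k --> \oo] --> (c * 0).
  by apply: cvgMr; apply: cvg_expr; rewrite ger0_norm ?invf_lt1 ?ltr1n.
rewrite mulr0 => /cvgrPdist_lt/(_ _ e0) [k0 _ h]; exists k0 => k /h /=.
by rewrite sub0r normrN ger0_norm ?mulr_ge0// exprn_ge0.
Qed.

Lemma geometric_sum_le n (x : nat -> 'rV[R]_n) c k j : 0 <= c ->
  (forall k, enorm (x k.+1 - x k) <= c * 2^-1 ^+ k) ->
  enorm (x (k + j)%N - x k) <= 2 * c * 2^-1 ^+ k.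
Proof.
move=> c0 xc.
have half_ge0 i : 0 <= 2^-1 ^+ i :> R by rewrite exprn_ge0.
(* Keeping the exact partial sum of the series, with its factor 1 - 2^-j, is what lets the induction
   on [j] close. *)
suff H : enorm (x (k + j)%N - x k) <= 2 * c * 2^-1 ^+ k * (1 - 2^-1 ^+ j).
  by rewrite (le_trans H)// ler_piMr ?mulr_ge0// gerBl.
elim: j => [|j IH]; first by rewrite addn0 subrr enorm0 expr0 subrr mulr0.
rewrite (le_trans (enorm_triangle _ (x (k + j)%N) _))// addnS.
rewrite (le_trans (lerD (xc _) IH))// exprD exprS.
by rewrite le_eqVlt; apply/orP; left; apply/eqP; field.
Qed.

Lemma geometric_cvg n (x : nat -> 'rV[R]_n) c : 0 <= c ->
  (forall k, enorm (x k.+1 - x k) <= c * 2^-1 ^+ k) ->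
  exists y, forall k, enorm (x k - y) <= 2 * c * 2^-1 ^+ k.
Proof.
move=> c0 xc.
have : cvg (x @ \oo).
  apply/cauchy_cvgP/cauchy_exP => e e0; rewrite /fmap/=.
  have [k0 kc] := geometric_small (mulr_ge0 (ler0n R 2) c0) e0.
  exists (x k0); exists k0 => // k /= k0k; rewrite -ball_normE /= distrC.
  rewrite (le_lt_trans (normr_le_enorm _))// -(subnKC k0k).
  by rewrite (le_lt_trans (geometric_sum_le _ _ c0 xc))// kc.
move=> /cvg_ex[y xy]; exists y => k; apply/ler_addgt0Pr => e e0.
have [j _ /(_ (k + j)%N (leq_addl _ _)) xjy] := cvg_enorm_lt xy e0.
rewrite (le_trans (enorm_triangle _ (x (k + j)%N) _))// lerD ?(ltW xjy)//.
by rewrite enormB geometric_sum_le.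
Qed.

End EuclideanNorm.
#[local] Hint Extern 0 (is_true (0 <= enorm _)) => exact: enorm_ge0 : core.

(** * Quadratic Taylor estimates for smooth maps *)

Section Calculus.
Variable R : realType.

(** A division-free form of the directional derivative: it also covers h = 0 and bounds the
    remainder directly in the Euclidean norm. *)
Lemma is_derive_enormP (V : normedModType R) n (g : V -> 'rV[R]_n) (x v : V) d :
  is_derive x v g d <->
  forall e : R, 0 < e -> exists2 dl : R, 0 < dl & forall h : R, `|h| < dl ->
    enorm (g (x + h *: v) - g x - h *: d) <= e * `|h|.
Proof.
split=> [[gxv <-] e e0|H].
  move: gxv => /(@cvg_enorm_lt R n R (0^') _ _ _ e)/(_ e0).
  rewrite near_withinE => /nbhs_ballP[dl /= dl0 H]; exists dl => // h hdl.
  have [->|h0] := eqVneq h 0.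
    by rewrite !scale0r addr0 subrr subr0 enorm0 normr0 mulr0.
  have /H/(_ h0)/ltW /= : ball (0 : R) dl h by rewrite -ball_normE /= sub0r normrN.
  rewrite -[lim _]/('D_v g x) => H1.
  have hn : 0 < `|h| by rewrite normr_gt0.
  rewrite -(ler_pM2l hn) -enormZ in H1.
  rewrite mulrC (le_trans _ H1)// le_eqVlt; apply/orP; left; apply/eqP.
  by rewrite enormZ -enormZ scalerBr scalerA divff// scale1r (addrC x).
have gd : h^-1 *: ((g \o shift x) (h *: v) - g x) @[h --> 0^'] --> d.
  apply/cvgrPdist_le => e e0; rewrite near_withinE.
  have [dl dl0 H1] := H e e0.
  apply/nbhs_ballP; exists dl => //= h; rewrite -ball_normE /= sub0r normrN.
  move=> /H1 H2 h0; rewrite distrC (le_trans (normr_le_enorm _))//.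
  have hn : 0 < `|h| by rewrite normr_gt0.
  rewrite -(ler_pM2l hn) -enormZ scalerBr scalerA divff// scale1r mulrC.
  by rewrite (addrC _ x).
by split; [apply/cvg_ex; exists d|apply/cvg_lim].
Qed.

Lemma is_derive_dirZ (V : normedModType R) n (g : V -> 'rV[R]_n) (x v : V) d a :
  is_derive x v g d -> is_derive x (a *: v) g (a *: d).
Proof.
move=> /is_derive_enormP H; apply/is_derive_enormP => e e0.
(* Dividing by |a| + 1 instead of |a| covers a = 0 as well. *)
have a1 : 0 < `|a| + 1 by rewrite ltr_wpDl.
have [dl dl0 H1] := H _ (divr_gt0 e0 a1).
exists (dl / (`|a| + 1)) => [|h hdl]; first exact: divr_gt0.
have ha : `|h * a| < dl.
  move: hdl; rewrite ltr_pdivlMr// normrM; apply: le_lt_trans.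
  by rewrite ler_wpM2l// lerDl.
rewrite !scalerA (le_trans (H1 _ ha))// normrM.
rewrite mulrAC ler_pdivrMr// -mulrA ler_wpM2l ?(ltW e0)// ler_wpM2l//.
by rewrite lerDl.
Qed.

(** The mean value theorem fails for vector values, so it is applied to one coordinate along the
    segment; the intermediate point depends on [j]. *)
Lemma mvt_coord n p (g : 'rV[R]_n -> 'rV[R]_p) (x v : 'rV[R]_n) j :
  (forall t : R, 0 <= t <= 1 -> derivable g (x + t *: v) v) ->
  exists2 s : R, 0 <= s <= 1 & (g (x + v) - g x) ord0 j = 'D_v g (x + s *: v) ord0 j.
Proof.
move=> gxv; pose f (t : R) : R := g (x + t *: v) ord0 j.
have fD (t : R) : 0 <= t <= 1 -> is_derive t (1 : R) f ('D_v g (x + t *: v) ord0 j).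
  move=> /gxv gt; have gtj := (derivable_mxP _ _ _).1 gt ord0 j.
  have E : (fun h : R => h^-1 *: ((f \o shift t) (h *: (1 : R)) - f t)) =
      (fun h : R => h^-1 *: (((fun y => g y ord0 j) \o shift (x + t *: v)) (h *: v) -
                          g (x + t *: v) ord0 j)).
    apply/funext => h /=; rewrite /f.
    have -> // : x + (h *: (1 : R) + t) *: v = h *: v + (x + t *: v).
    by rewrite [h *: _]mulr1 scalerDl addrCA.
  split; first by rewrite /derivable E.
  by rewrite derive_mx// mxE /derive E.
have cf : {within `[0, 1], continuous f}.
  apply: derivable_within_continuous => t; rewrite in_itv /= => t01.
  by have [] := fD _ t01.
have [t|s s01] := @MVT_segment _ f (fun t => 'D_v g (x + t *: v) ord0 j) 0 1 ler01 _ cf.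
  by rewrite in_itv /= => /andP[t0 t1]; apply: fD; rewrite !ltW.
rewrite /f subr0 mulr1 scale1r scale0r addr0 => H.
by exists s; [move: s01; rewrite in_itv|rewrite -H !mxE].
Qed.

(** [iter_dder] is a right fold, so a direction appended at the end of the list is the first one
    differentiated. *)
Lemma smooth_on_derive n p U (g : 'rV[R]_n -> 'rV[R]_p) (v : 'rV[R]_n) :
  smooth_on U g -> smooth_on U ('D_v g).
Proof.
move=> sg vs; have := sg (rcons vs v).
by rewrite /iter_dder foldr_rcons.
Qed.

Lemma smooth_on_is_derive n p U (g : 'rV[R]_n -> 'rV[R]_p) (x v : 'rV[R]_n) :
  U x -> smooth_on U g -> is_derive x v g ('D_v g x).
Proof. by move=> Ux sg; exact: DeriveDef ((sg [::]).2 x v Ux) erefl. Qed.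

Lemma ball_convex n (c x y : 'rV[R]_n) r s : 0 <= s <= 1 ->
  enorm (x - c) < r -> enorm (y - c) < r -> enorm (x + s *: (y - x) - c) < r.
Proof.
move=> /andP[s0 s1] xr yr.
have -> : x + s *: (y - x) - c = (1 - s) *: (x - c) + s *: (y - c).
  by apply/rowP => i; rewrite !mxE; ring.
rewrite (le_lt_trans (enormD _ _))// !enormZ !ger0_norm ?subr_ge0//.
have [s1'|s1'] := ltP s 1; first by nra.
have -> : s = 1 by apply/le_anti; rewrite s1.
by rewrite subrr mul0r add0r mul1r.
Qed.

(** The increment is split along the broken path x, x + hu, x + hu + hv. The first leg is the
    derivative at x; the second is handled by the mean value theorem and the continuity of ['D_v g]
    at x. *)
Lemma derive_dirD n p U (g : 'rV[R]_n -> 'rV[R]_p) (x u v : 'rV[R]_n) : open U -> U x ->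
  smooth_on U g -> 'D_(u + v) g x = 'D_u g x + 'D_v g x.
Proof.
move=> oU Ux sg.
suff [_ ->//] : is_derive x (u + v) g ('D_u g x + 'D_v g x).
apply/is_derive_enormP => e e0.
have gu : is_derive x u g ('D_u g x) by exact: (smooth_on_is_derive _ _ sg).
have p1 : 0 < p%:R + 1 :> R by rewrite ltr_wpDl.
(* Each leg gets half of [e]; reassembling the [p] coordinates of the second leg costs a factor
   p. *)
pose e' := e / 2 / (p%:R + 1).
have e'0 : 0 < e' by rewrite !divr_gt0.
have e2 : 0 < e / 2 by rewrite divr_gt0.
have [d1 d10 H1] := (is_derive_enormP _ _ _ _).1 gu _ e2.
have cv : {for x, continuous ('D_v g)} by exact: (sg [:: v]).1.
have [d2 d20 H2] := nbhs_enorm (cvg_enorm_lt cv e'0).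
have [d3 d30 H3] := nbhs_enorm (open_nbhs_nbhs (conj oU Ux)).
pose K := enorm u + enorm v + 1.
have K0 : 0 < K by rewrite ltr_wpDl// addr_ge0.
(* Every point of the second leg is within |h| K of x, hence in [U] and where ['D_v g] is close to
   its value at x. *)
exists (Num.min d1 (Num.min d2 d3 / K)) => [|h].
  by rewrite lt_min d10 divr_gt0// lt_min d20.
rewrite lt_min ltr_pdivlMr// lt_min => /and3P[h1 h2 h3].
have near s : 0 <= s <= 1 -> enorm (x + h *: u + s *: (h *: v) - x) <= `|h| * K.
  move=> /andP[s0 s1].
  have -> : x + h *: u + s *: (h *: v) - x = h *: u + (s * h) *: v.
    by apply/rowP => i; rewrite !mxE; ring.
  rewrite (le_trans (enormD _ _))// !enormZ normrM (ger0_norm s0).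
  have := normr_ge0 h; have := enorm_ge0 u; have := enorm_ge0 v.
  rewrite /K; set a := enorm u; set b := enorm v; set c := `|h| => b0 a0 c0.
  have : s * (c * b) <= c * b by rewrite ler_piMl// mulr_ge0.
  nra.
have -> : g (x + h *: (u + v)) - g x - h *: ('D_u g x + 'D_v g x) =
    (g (x + h *: u) - g x - h *: 'D_u g x) +
    (g (x + h *: u + h *: v) - g (x + h *: u) - h *: 'D_v g x).
  have tele (a b y y' w : 'rV[R]_p) : w - a - (y + y') = (b - a - y) + (w - b - y').
    by apply/rowP => i; rewrite !mxE; ring.
  by rewrite !scalerDr addrA -tele.
apply: le_trans (enormD _ _) _; rewrite (splitr e) mulrDl.
apply: lerD; first exact: H1.
apply: (@le_trans _ _ (p%:R * (e' * `|h|))).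
  apply: enorm_le_coord => j.
  have dv y : U y -> derivable g y (h *: v) by move=> Uy; exact: (sg [::]).2.
  have [t t01|s s01 Hs] := @mvt_coord _ _ g (x + h *: u) (h *: v) j.
    by apply/dv/H3; rewrite (le_lt_trans (near _ t01)).
  set y := (x + h *: u + s *: (h *: v)) in Hs.
  have yK : enorm (y - x) <= `|h| * K by exact: near.
  have Uy : U y by apply/H3; rewrite (le_lt_trans yK).
  have E : 'D_(h *: v) g y = h *: 'D_v g y.
    have gv : is_derive y v g ('D_v g y) by exact: (smooth_on_is_derive _ _ sg).
    by have [] := is_derive_dirZ h gv.
  rewrite [X in `|X|]mxE Hs E !mxE -mulrBr normrM mulrC ler_wpM2r//.
  have /ltW : enorm ('D_v g y - 'D_v g x) < e' by apply: H2; rewrite (le_lt_trans yK).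
  by apply: le_trans; rewrite (le_trans _ (normr_coord_le _ j))// !mxE.
rewrite mulrA ler_wpM2r// /e' mulrCA ler_piMr ?(ltW e2)//.
by rewrite ler_pdivrMr// mul1r lerDl.
Qed.

(** Assembled from directional derivatives, the only ones [smooth_on] speaks of, and laid out so
    that Dg(x) acts on row vectors by right multiplication. *)
Definition Dmx n p (g : 'rV[R]_n -> 'rV[R]_p) (x : 'rV[R]_n) : 'M[R]_(n, p) :=
  \matrix_(i, j) 'D_(delta_mx 0 i) g x ord0 j.

Lemma deriveE_Dmx n p U (g : 'rV[R]_n -> 'rV[R]_p) (x v : 'rV[R]_n) : open U -> U x ->
  smooth_on U g -> 'D_v g x = v *m Dmx g x.
Proof.
move=> oU Ux sg.
have sumD (s : seq 'I_n) (f : 'I_n -> 'rV[R]_n) :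
    'D_(\sum_(i <- s) f i) g x = \sum_(i <- s) 'D_(f i) g x.
  elim: s => [|i s IH]; first by rewrite !big_nil derive0.
  by rewrite !big_cons (derive_dirD _ _ oU)// IH.
rewrite {1}(row_sum_delta v) sumD mulmx_sum_row; apply: eq_bigr => i _.
have -> : row i (Dmx g x) = 'D_(delta_mx 0 i) g x by apply/rowP => j; rewrite !mxE.
have gi : is_derive x (delta_mx 0 i) g ('D_(delta_mx 0 i) g x).
  by exact: (smooth_on_is_derive _ _ sg).
by have [] := is_derive_dirZ (v ord0 i) gi.
Qed.

Lemma enorm_mulmx_rows n p (A : 'M[R]_(n, p)) (v : 'rV[R]_n) c :
  (forall i, enorm (row i A) <= c) -> enorm (v *m A) <= n%:R * c * enorm v.
Proof.
move=> Ac; rewrite mulmx_sum_row (le_trans (enorm_sum _ _))//.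
have -> : n%:R * c * enorm v = \sum_(i < n) enorm v * c.
  by rewrite sumr_const card_ord -mulrA (mulrC c) mulr_natl.
by apply: ler_sum => i _; rewrite enormZ ler_pM// normr_coord_le.
Qed.

(** Continuity bounds the partial derivatives near [c], and the mean value theorem turns this into a
    Lipschitz bound. Stating it for all small radii lets finitely many such bounds be combined. *)
Lemma smooth_on_lipschitz n p U (g : 'rV[R]_n -> 'rV[R]_p) (c : 'rV[R]_n) : open U -> U c ->
  smooth_on U g ->
  exists C, \forall r \near 0^'+, forall x y,
    enorm (x - c) < r -> enorm (y - c) < r -> enorm (g y - g x) <= C * enorm (y - x).
Proof.
move=> oU Uc sg.
have [d0 d00 HU] := nbhs_enorm (open_nbhs_nbhs (conj oU Uc)).
pose D i := 'D_(delta_mx 0 i) g.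
pose B := \sum_i enorm (D i c) + 1.
have DB i : \forall x \near c, enorm (D i x) <= B.
  have : {for c, continuous (D i)} by exact: (sg [:: delta_mx 0 i]).1.
  move=> /cvg_enorm_lt/(_ ltr01); apply: filterS => x /ltW Dx.
  apply: le_trans (enorm_sub _ (D i c)) _; apply: lerD => //.
  by rewrite (bigD1 i)//= lerDl sumr_ge0.
have /nbhs_enorm[d1 d10 HB] := filter_forall (nbhs_filter c) DB.
exists (p%:R * (n%:R * B)); near=> r => x y xr yr.
rewrite -mulrA; apply: enorm_le_coord => j.
have rd0 : r < d0 by near: r; exact: nbhs_right_lt.
have rd1 : r < d1 by near: r; exact: nbhs_right_lt.
have [t t01|s s01] := @mvt_coord _ _ g x (y - x) j.
  by apply: (sg [::]).2; apply/HU; rewrite (lt_trans _ rd0)// ball_convex.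
rewrite addrCA subrr addr0 => ->; set z := x + _.
have zr : enorm (z - c) < r by exact: ball_convex.
rewrite (deriveE_Dmx _ oU)//; last by apply: HU; exact: lt_trans rd0.
rewrite (le_trans (normr_coord_le _ _))// enorm_mulmx_rows// => i.
have -> : row i (Dmx g z) = D i z by apply/rowP => k; rewrite !mxE.
by apply: HB; exact: lt_trans rd1.
Unshelve. all: by end_near. Qed.

(** The partial derivatives are smooth too, hence Lipschitz, which is the bound on Dg. The remainder
    follows by the mean value theorem, comparing Dg at the intermediate point with Dg(x). *)
Lemma smooth_on_taylor n p U (g : 'rV[R]_n -> 'rV[R]_p) (c : 'rV[R]_n) : open U -> U c ->
  smooth_on U g ->
  exists C r, [/\ 0 < C, 0 < r, (forall x, enorm (x - c) < r -> U x),
    (forall x y v, enorm (x - c) < r -> enorm (y - c) < r ->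
       enorm (v *m Dmx g y - v *m Dmx g x) <= C * enorm (y - x) * enorm v) &
    (forall x y, enorm (x - c) < r -> enorm (y - c) < r ->
       enorm (g y - g x - (y - x) *m Dmx g x) <= C * enorm (y - x) ^+ 2)].
Proof.
move=> oU Uc sg.
have [d0 d00 HU] := nbhs_enorm (open_nbhs_nbhs (conj oU Uc)).
pose D i := 'D_(delta_mx 0 i) g.
have /choice[L HL] : forall i, exists C, \forall r \near 0^'+, forall x y,
    enorm (x - c) < r -> enorm (y - c) < r ->
    enorm (D i y - D i x) <= C * enorm (y - x).
  by move=> i; apply: (smooth_on_lipschitz oU Uc); exact: smooth_on_derive.
pose B := n%:R * \sum_i `|L i|.
have B0 : 0 <= B by rewrite mulr_ge0// sumr_ge0.
have [r [r0 [rd0 Hr]]] : exists r, 0 < r /\ r < d0 /\ forall i x y,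
    enorm (x - c) < r -> enorm (y - c) < r ->
    enorm (D i y - D i x) <= L i * enorm (y - x).
  have : \forall r \near 0^'+, r < d0 /\ 0 < r /\ forall i x y,
      enorm (x - c) < r -> enorm (y - c) < r ->
      enorm (D i y - D i x) <= L i * enorm (y - x).
    near=> r; split; [|split].
    - by near: r; exact: nbhs_right_lt.
    - by near: r; exact: nbhs_right_gt.
    - by near: r; exact: filter_forall.
  by move=> /filter_ex[r [? [? ?]]]; exists r.
have HD x y v : enorm (x - c) < r -> enorm (y - c) < r ->
    enorm (v *m Dmx g y - v *m Dmx g x) <= B * enorm (y - x) * enorm v.
  move=> xr yr; rewrite -mulmxBr /B -(mulrA n%:R).
  apply: enorm_mulmx_rows => i.
  have -> : row i (Dmx g y - Dmx g x) = D i y - D i x by apply/rowP => k; rewrite !mxE.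
  rewrite (le_trans (Hr _ _ _ xr yr))// ler_wpM2r// (le_trans (ler_norm _))//.
  by rewrite (bigD1 i)//= lerDl sumr_ge0.
(* One positive constant that dominates both [B], for the variation of Dg, and p B, for the
   remainder summed over coordinates. *)
have C0 : 0 < (p%:R + 1) * (B + 1) by rewrite mulr_gt0// ltr_wpDl.
have BC : B <= (p%:R + 1) * (B + 1).
  by have := ler0n R p; nra.
exists ((p%:R + 1) * (B + 1)), r; split=> //.
- by move=> x xr; apply: HU; exact: lt_trans rd0.
- move=> x y v xr yr; rewrite (le_trans (HD _ _ _ xr yr))//.
  by rewrite ler_wpM2r// ler_wpM2r.
- move=> x y xr yr; apply: (@le_trans _ _ (p%:R * (B * enorm (y - x) ^+ 2))).
    apply: enorm_le_coord => j.
    have dU z : enorm (z - c) < r -> U z by move=> ?; apply: HU; exact: lt_trans rd0.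
    have [t t01|s s01] := @mvt_coord _ _ g x (y - x) j.
      by apply: (sg [::]).2; apply: dU; exact: ball_convex.
    rewrite addrCA subrr addr0; set z := x + _ => Hs.
    have zr : enorm (z - c) < r by exact: ball_convex.
    rewrite [X in `|X|]mxE Hs (deriveE_Dmx _ oU)//; last exact: dU.
    have -> : ((y - x) *m Dmx g z) ord0 j + (- ((y - x) *m Dmx g x)) ord0 j =
       ((y - x) *m Dmx g z - (y - x) *m Dmx g x) ord0 j by rewrite [RHS]mxE.
    rewrite (le_trans (normr_coord_le _ _))// (le_trans (HD _ _ _ xr zr))//.
    rewrite expr2 mulrA ler_wpM2r// ler_wpM2l//.
    have -> : z - x = s *: (y - x) by rewrite /z addrAC subrr add0r.
    move: s01 => /andP[s0 s1].
    by rewrite enormZ ger0_norm// ler_piMl.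
  rewrite mulrA ler_wpM2r ?exprn_ge0//.
  by have := ler0n R p; nra.
Unshelve. all: by end_near. Qed.

End Calculus.

(** * Local equations and tangent spaces *)

Section TangentProjection.
Variable R : realType.

Lemma ler_scaled_addgt0 (a b K : R) : 0 < K ->
  (forall e : R, 0 < e -> a <= b + K * e) -> a <= b.
Proof.
move=> K0 H; apply/ler_addgt0Pr => e e0.
have := H (e / K) (divr_gt0 e0 K0).
by rewrite mulrCA divff ?mulr1// gt_eqF.
Qed.

(** The residual v - Qv is orthogonal to u and to Qv, so its square equals its product with v - u;
    Cauchy-Schwarz concludes. *)
Lemma tangent_proj_closest n (M : set 'rV[R]_n) x Q v u :
  is_tangent_proj M x Q -> tangent_space M x u ->
  enorm (v - app Q v) <= enorm (v - u).
Proof.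
move=> MQ Tu; have [TQ orth] := MQ v.
set a := v - app Q v; have [->|a0] := eqVneq a 0; first by rewrite enorm0.
have : enorm a ^+ 2 <= enorm a * enorm (v - u).
  rewrite enorm_sqr; apply: le_trans (edot_le _ _).
  have Ea : a = (v - u) + (u - app Q v) by rewrite subrKA.
  by rewrite {2}Ea edotDr (edotDr u) edotNr (orth _ Tu) (orth _ TQ) subrr addr0.
by rewrite expr2 ler_pM2l// enorm_gt0.
Qed.

(** First-order optimality: a curve in M through z with velocity u cannot come closer to y in either
    time direction. *)
Lemma nearest_point_orth n (M : set 'rV[R]_n) y z u :
  nearest_point M y z -> tangent_space M z u -> edot (y - z) u = 0.
Proof.
move=> [Mz near] [gam [g0 Mgam /is_derive_enormP gu]].
(* The sign [s] selects forward or backward motion along the curve. *)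
suff H (s : R) : `|s| = 1 -> s * edot (y - z) u <= 0.
  have := H 1; rewrite normr1 => /(_ erefl).
  have := H (-1); rewrite normrN1 => /(_ erefl); lra.
move=> s1; set E := enorm (y - z); set N := enorm u.
have N0 : 0 <= N by exact: enorm_ge0.
have E0 : 0 <= E by exact: enorm_ge0.
apply: (@ler_scaled_addgt0 _ _ (2 * E + 1)); first by rewrite ltr_wpDl// mulr_ge0.
move=> e e0; rewrite add0r.
have [d d0 Hd] := gu _ e0.
move: Mgam => /nbhs_ballP[d' /= d'0 Hd'].
have q0 : 0 < (N + e) ^+ 2 by rewrite exprn_gt0// ltr_wpDl.
(* The last bound makes the quadratic term (t (N + e))^2 at most t e, so it survives division by [t]
   as an error of order [e]. *)
pose t := Num.min (Num.min (d / 2) (d' / 2)) (e / (N + e) ^+ 2).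
have t0 : 0 < t by rewrite !lt_min !divr_gt0.
have td : t < d.
  by rewrite (@le_lt_trans _ _ (d / 2)) ?ge_min ?lexx// ltr_pdivrMr// ltr_pMr ?ltr1n.
have td' : t < d'.
  rewrite (@le_lt_trans _ _ (d' / 2)) ?ge_min ?lexx ?orbT//.
  by rewrite ltr_pdivrMr// ltr_pMr ?ltr1n.
have te : t * (N + e) ^+ 2 <= e by rewrite -ler_pdivlMr// ge_min lexx orbT.
have nst : `|s * t| = t by rewrite normrM s1 mul1r gtr0_norm.
have Mg : M (gam (s * t)) by apply: Hd'; rewrite -ball_normE /= sub0r normrN nst.
have := near _ Mg; rewrite -/E.
have := Hd (s * t); rewrite nst g0 add0r => /(_ td).
rewrite [(s * t) *: (1 : R)]mulr1; set h := _ - (s * t) *: u => hh.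
have -> : y - gam (s * t) = (y - z) - ((s * t) *: u + h).
  by apply/rowP => i; rewrite !mxE; ring.
set k := _ *: u + h.
have kN : enorm k <= t * (N + e).
  by rewrite (le_trans (enormD _ _))// enormZ nst mulrDr lerD// mulrC.
move=> near1; have : E ^+ 2 <= enorm (y - z - k) ^+ 2 by rewrite lerXn2r ?nnegrE.
rewrite (enormB_sqr (y - z) k) -/E.
have := edot_le (y - z) (- h); rewrite edotNr enormN -/E.
have -> : edot (y - z) k = s * t * edot (y - z) u + edot (y - z) h by rewrite [LHS]edotDr edotZr.
have : enorm k ^+ 2 <= t * e.
  apply: (@le_trans _ _ ((t * (N + e)) ^+ 2)).
    by rewrite lerXn2r ?nnegrE// mulr_ge0 ?addr_ge0// ltW.
  by rewrite exprMn expr2 -mulrA ler_pM2l.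
have : E * enorm h <= E * (e * t) by rewrite ler_wpM2l.
set a := edot _ u; set b := edot _ h; set c := enorm k ^+ 2 => H1 H2 H3 H4.
have te0 : 0 <= t * e by rewrite mulr_ge0// ltW.
have Ete0 : 0 <= E * (t * e) by rewrite mulr_ge0.
rewrite -(ler_pM2l t0); lra.
Qed.

End TangentProjection.

(** * Solving a local equation of M and identifying its tangent spaces with kernels *)

Section Chart.
Variable R : realType.

(* [A x] is the matrix of Dg(x) acting on row vectors; the surjectivity of Dg(c) is
   witnessed by the right inverse [B]. *)
Record chart n p (M : set 'rV[R]_n) (c : 'rV[R]_n) (g : 'rV[R]_n -> 'rV[R]_p)
    (A : 'rV[R]_n -> 'M[R]_(n, p)) (B : 'M[R]_(p, n)) (C r : R) : Prop := Chart {
  chart_C_gt0 : 0 < C;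
  chart_r_gt0 : 0 < r;
  chart_mem : forall x, enorm (x - c) < r -> (M x <-> g x = 0);
  chart_rinv : B *m A c = 1%:M;
  chart_lip : forall x y v, enorm (x - c) < r -> enorm (y - c) < r ->
    enorm (v *m A y - v *m A x) <= C * enorm (y - x) * enorm v;
  chart_taylor : forall x y, enorm (x - c) < r -> enorm (y - c) < r ->
    enorm (g y - g x - (y - x) *m A x) <= C * enorm (y - x) ^+ 2 }.

Lemma chart_exists n (M : set 'rV[R]_n) c : embedded_submanifold M -> M c ->
  exists p g A B C r, @chart n p M c g A B C r.
Proof.
move=> [m [_ HM]] Mc; have [U [g [oU Uc sg surj Mg]]] := HM c Mc.
have [C [r [C0 r0 HU lip tay]]] := smooth_on_taylor oU Uc sg.
(* Preimages of the basis vectors under Dg(c); they become the rows of the right inverse. *)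
have /choice[V HV] : forall i : 'I_(n - m), exists v : 'rV[R]_n, v *m Dmx g c = delta_mx 0 i.
  move=> i; have [v Hv] := surj c Uc Mc (delta_mx 0 i).
  by exists v; rewrite -Hv (deriveE_Dmx _ oU).
exists (n - m)%N, g, (Dmx g), (\matrix_i V i), C, r; split=> //.
- by move=> x /HU; exact: Mg.
- by apply/row_matrixP => i; rewrite row_mul rowK HV rowE mulmx1.
Qed.

Section ChartTheory.
Variables (n p : nat) (M : set 'rV[R]_n) (c : 'rV[R]_n) (g : 'rV[R]_n -> 'rV[R]_p)
  (A : 'rV[R]_n -> 'M[R]_(n, p)) (B : 'M[R]_(p, n)) (C r : R).
Hypothesis Hch : chart M c g A B C r.
Variables (b s : R).
Hypothesis b0 : 0 < b.
Hypothesis Bb : forall w : 'rV_p, enorm (w *m B) <= b * enorm w.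
Hypothesis s0 : 0 < s.
Hypothesis sr : s <= r.
(** By [chart_strict], g differs from its linear part at [c] on the s-ball by a Lipschitz error 3 C
    s; composed with the right inverse of norm at most [b], it stays a contraction with factor
    1/2. *)
Hypothesis sb : 3 * C * s * b <= 2^-1.

Let C0 : 0 < C := chart_C_gt0 Hch.

(** Of the factor 3, two units come from the Taylor remainder, as |y - x| <= 2 s, and one from
    replacing A(x) by A(c). *)
Lemma chart_strict x y : enorm (x - c) < s -> enorm (y - c) < s ->
  enorm (g y - g x - (y - x) *m A c) <= 3 * C * s * enorm (y - x).
Proof.
move=> xs ys; have [xr yr] := (lt_le_trans xs sr, lt_le_trans ys sr).
have cr : enorm (c - c) < r by rewrite subrr enorm0 (chart_r_gt0 Hch).
have H1 := chart_taylor Hch xr yr.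
have H2 := chart_lip Hch (y - x) cr xr.
have -> : g y - g x - (y - x) *m A c =
    (g y - g x - (y - x) *m A x) + ((y - x) *m A x - (y - x) *m A c).
  by rewrite subrKA.
rewrite (le_trans (enormD _ _))// (le_trans (lerD H1 H2))//.
have : enorm (y - x) <= 2 * s.
  have := enorm_triangle y c x; rewrite (enormB c); lra.
have := enorm_ge0 (y - x); move: (enorm (y - x)) (enorm (x - c)) xs => d a xs d0 ds.
have : C * d * d <= C * d * (2 * s) by rewrite ler_wpM2l// mulr_ge0// ltW.
have : C * d * a <= C * d * s by rewrite ler_wpM2l ?(ltW xs)// mulr_ge0// ltW.
by rewrite expr2; lra.
Qed.

Lemma chart_lipschitz : exists2 L : R, 0 < L &
  forall x y, enorm (x - c) < s -> enorm (y - c) < s ->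
    enorm (g y - g x) <= L * enorm (y - x).
Proof.
have [a a0 Aa] := mulmx_bounded (A c).
exists (3 * C * s + a) => [|x y xs ys]; first by rewrite !addr_gt0// !mulr_gt0.
rewrite (le_trans (enorm_sub _ ((y - x) *m A c)))// addrC mulrDl lerD//.
exact: chart_strict.
Qed.

(* Simplified Newton iteration w <- w - g (z + w B); by [chart_strict] and B A(c) = 1
   its steps shrink by the factor 3 C s b <= 1/2. *)
Lemma chart_solve z : enorm (z - c) < s / 2 -> b * (2 * enorm (g z)) < s / 2 ->
  exists2 w, enorm w <= 2 * enorm (g z) & g (z + w *m B) = 0.
Proof.
move=> zs gz; set e := enorm (g z) in gz *.
have e0 : 0 <= e by exact: enorm_ge0.
pose w := fix w k := if k is k'.+1 then w k' - g (z + w k' *m B) else 0 : 'rV[R]_p.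
have inball v : enorm v <= 2 * e -> enorm (z + v *m B - c) < s.
  move=> ve; rewrite addrAC (le_lt_trans (enormD _ _))// [s]splitr ltrD//.
  by rewrite (le_lt_trans (Bb v))// (le_lt_trans _ gz)// ler_pM2l.
have half_ge0 i : 0 <= 2^-1 ^+ i :> R by rewrite exprn_ge0.
have wk k : enorm (w k) <= 2 * e * (1 - 2^-1 ^+ k) /\
            enorm (g (z + w k *m B)) <= e * 2^-1 ^+ k.
  elim: k => [|k [IH1 IH2]].
    by rewrite /= mul0mx addr0 expr0 subrr mulr0 enorm0 mulr1.
  have H1 : enorm (w k.+1) <= 2 * e * (1 - 2^-1 ^+ k.+1).
    rewrite (le_trans (enormD _ _))// enormN (le_trans (lerD IH1 IH2))//.
    by rewrite exprS le_eqVlt; apply/orP; left; apply/eqP; field.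
  split=> //.
  have bd j : 2 * e * (1 - 2^-1 ^+ j) <= 2 * e by rewrite ler_piMr ?mulr_ge0// gerBl.
  have := chart_strict (inball _ (le_trans IH1 (bd _))) (inball _ (le_trans H1 (bd _))).
  have -> : z + w k.+1 *m B - (z + w k *m B) = - g (z + w k *m B) *m B.
    by rewrite /= mulmxBl mulNmx opprD addrACA subrr add0r addrAC subrr add0r.
  (* As B A(c) = 1, the linear prediction cancels the old residual, so the strict estimate bounds
     the new residual itself. *)
  rewrite -mulmxA (chart_rinv Hch) mulmx1 opprK subrK => H.
  rewrite (le_trans H)// (le_trans (ler_wpM2l _ (Bb _))) ?mulr_ge0 ?(ltW s0) ?(ltW C0)//.
  rewrite enormN mulrA exprS.
  have := ler_pM (_ : 0 <= 3 * C * s * b) (enorm_ge0 _) sb IH2.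
  by rewrite (mulrCA e); apply; rewrite !mulr_ge0// ltW.
have wS k : enorm (w k.+1 - w k) <= e * 2^-1 ^+ k.
  by rewrite /= addrAC subrr add0r enormN; exact: (wk k).2.
have [v Hv] := geometric_cvg e0 wS.
have v2 : enorm v <= 2 * e.
  by have := Hv 0%N; rewrite /= sub0r enormN expr0 mulr1.
exists v => //; apply: enorm_eq0; apply/le_anti; rewrite enorm_ge0 andbT.
have [L L0 HL] := chart_lipschitz.
apply/ler_addgt0Pr => a a0; rewrite add0r.
have K0 : 0 <= L * (b * (2 * e)) + e by rewrite addr_ge0// !mulr_ge0// ltW.
have [k0 /(_ k0 (leqnn _)) Hk] := geometric_small K0 a0.
have wk2 : enorm (w k0) <= 2 * e.
  by rewrite (le_trans (wk k0).1)// ler_piMr ?mulr_ge0// gerBl.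
apply: le_trans (ltW Hk).
rewrite (le_trans (enorm_sub _ (g (z + w k0 *m B))))// mulrDl addrC lerD//; last exact: (wk k0).2.
rewrite (le_trans (HL _ _ (inball _ wk2) (inball _ v2)))// -!mulrA ler_pM2l//.
rewrite opprD addrACA subrr add0r -mulmxBl (le_trans (Bb _))// ler_pM2l//.
by rewrite enormB mulrA; exact: Hv.
Qed.

(* The curve is t |-> x + t u + w(t) B, where w(t) = O(t^2) corrects g to zero. *)
Lemma ker_tangent x u : M x -> enorm (x - c) < s / 4 -> u *m A x = 0 ->
  tangent_space M x u.
Proof.
move=> Mx xs uA.
have half_lt : s / 2 < s by rewrite ltr_pdivrMr// ltr_pMr ?ltr1n.
have xr : enorm (x - c) < r by move: (lt_le_trans half_lt sr); lra.
have gx : g x = 0 by exact/(chart_mem Hch xr).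
(* For |t| < t0 the point x + t u stays within s / 2 of [c], where [chart_solve] applies. *)
pose t0 := s / 4 / (enorm u + 1).
have u1 : 0 < enorm u + 1 by rewrite ltr_wpDl.
have t00 : 0 < t0 by rewrite !divr_gt0.
have small (t : R) : `|t| < t0 -> `|t| * enorm u < s / 4.
  rewrite ltr_pdivlMr// => h; rewrite (le_lt_trans _ h)// ler_wpM2l//.
  by rewrite lerDl.
have zs (t : R) : `|t| < t0 -> enorm (x + t *: u - c) < s / 2.
  move=> /small tu; rewrite addrAC (le_lt_trans (enormD _ _))// enormZ.
  have -> : s / 2 = s / 4 + s / 4 by field.
  exact: ltrD.
have gz (t : R) : `|t| < t0 -> enorm (g (x + t *: u)) <= C * (`|t| * enorm u) ^+ 2.
  move=> tt; have := chart_taylor Hch xr (_ : enorm (x + t *: u - c) < r).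
  rewrite gx subr0 [x + _]addrC addrK -scalemxAl uA scaler0 subr0 enormZ; apply.
  by rewrite addrC (lt_le_trans _ sr)// (lt_trans (zs _ tt)).
have bC : b * (2 * (C * (s / 4) ^+ 2)) < s / 2.
  have -> : b * (2 * (C * (s / 4) ^+ 2)) = (3 * C * s * b) * (s / 24) by field.
  rewrite (le_lt_trans (ler_wpM2r _ sb)) ?divr_ge0 ?(ltW s0)//; lra.
have /choice[w Hw] : forall t : R, exists v, `|t| < t0 ->
    enorm v <= 2 * (C * (`|t| * enorm u) ^+ 2) /\ g (x + t *: u + v *m B) = 0.
  move=> t; have [tt|_] := ltP `|t| t0; last by exists 0.
  have tu : C * (`|t| * enorm u) ^+ 2 <= C * (s / 4) ^+ 2.
    by rewrite ler_pM2l// lerXn2r ?nnegrE ?mulr_ge0 ?divr_ge0 ?(ltW s0)// ltW// small.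
  have [||v v1 v2] := @chart_solve (x + t *: u).
  - exact: zs.
  - rewrite (le_lt_trans _ bC)// !ler_pM2l// (le_trans (gz _ tt))//.
  by exists v => _; split=> //; rewrite (le_trans v1)// ler_pM2l// gz.
(* The quadratic bound on the chosen correction forces it to vanish at 0, so the curve starts at
   x. *)
have w0 : w 0 = 0.
  have [|+ _] := Hw 0; first by rewrite normr0.
  rewrite normr0 mul0r expr0n !mulr0 => h; apply: enorm_eq0.
  by apply/le_anti; rewrite h enorm_ge0.
pose gam (t : R) := x + t *: u + w t *m B.
have gam0 : gam 0 = x by rewrite /gam w0 mul0mx scale0r !addr0.
exists gam; split=> //.
- apply/nbhs_ballP; exists t0 => //= t; rewrite -ball_normE /= sub0r normrN => tt.
  have [w1 w2] := Hw t tt.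
  apply/(chart_mem Hch) => //; rewrite (lt_le_trans _ sr)//.
  rewrite /gam addrAC (le_lt_trans (enormD _ _))// [s]splitr ltrD//; first exact: zs.
  rewrite (le_lt_trans (Bb _))// (le_lt_trans _ bC)// ler_pM2l//.
  rewrite (le_trans w1)// !ler_pM2l//.
  by rewrite lerXn2r ?nnegrE ?mulr_ge0 ?divr_ge0 ?(ltW s0)// ltW// small.
- apply/is_derive_enormP => e e0.
  pose K := b * (2 * (C * enorm u ^+ 2)) + 1.
  have K0 : 0 < K by rewrite ltr_wpDl// !mulr_ge0// ?exprn_ge0// ltW.
  exists (Num.min t0 (e / K)) => [|t]; first by rewrite lt_min t00 divr_gt0.
  rewrite lt_min => /andP[tt]; rewrite ltr_pdivlMr// => te.
  rewrite add0r gam0 [t *: (1 : R)]mulr1.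
  have -> : gam t - x - t *: u = w t *m B.
    by apply/rowP => i; rewrite !mxE; ring.
  have [w1 _] := Hw t tt.
  rewrite (le_trans (Bb _))// (le_trans (ler_wpM2l (ltW b0) w1))//.
  rewrite exprMn.
  have -> : b * (2 * (C * (`|t| ^+ 2 * enorm u ^+ 2))) =
     `|t| * (b * (2 * (C * enorm u ^+ 2))) * `|t| by ring.
  rewrite ler_wpM2r// (le_trans _ (ltW te))// ler_wpM2l// lerDl//.
Qed.

(** Along a curve in M through x, g vanishes, so Taylor at x gives (gam t - x) A(x) = O(t^2);
    dividing by t yields u A(x) = 0. *)
Lemma tangent_ker x u : M x -> enorm (x - c) < r -> tangent_space M x u ->
  u *m A x = 0.
Proof.
move=> Mx xr [gam [g0 Mgam /is_derive_enormP gu]].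
have gx : g x = 0 by exact/(chart_mem Hch xr).
have [a a0 Aa] := mulmx_bounded (A x).
apply: enorm_eq0; apply/le_anti; rewrite enorm_ge0 andbT.
apply: (@ler_scaled_addgt0 _ _ _ (a + 1)); first by rewrite addr_gt0.
move=> e e0; rewrite add0r.
have [d d0 Hd] := gu _ e0.
move: Mgam => /nbhs_ballP[d' /= d'0 Hd'].
set N := enorm u.
have N0 : 0 <= N by exact: enorm_ge0.
have q0 : 0 < C * (N + e) ^+ 2 by rewrite mulr_gt0// exprn_gt0// ltr_wpDl.
have Ne : 0 < N + e by rewrite ltr_wpDl.
have rx : 0 < r - enorm (x - c) by rewrite subr_gt0.
pose t := Num.min (Num.min (d / 2) (d' / 2))
  (Num.min (e / (C * (N + e) ^+ 2)) ((r - enorm (x - c)) / 2 / (N + e))).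
have t0 : 0 < t by rewrite !lt_min !divr_gt0.
have td : t < d.
  by rewrite (@le_lt_trans _ _ (d / 2)) ?ge_min ?lexx// ltr_pdivrMr// ltr_pMr ?ltr1n.
have td' : t < d'.
  rewrite (@le_lt_trans _ _ (d' / 2)) ?ge_min ?lexx ?orbT//.
  by rewrite ltr_pdivrMr// ltr_pMr ?ltr1n.
have te : t * (C * (N + e) ^+ 2) <= e.
  by rewrite -ler_pdivlMr// !ge_min lexx !orbT.
have tr : t * (N + e) < r - enorm (x - c).
  apply: (@le_lt_trans _ _ ((r - enorm (x - c)) / 2)).
    by rewrite -ler_pdivlMr// !ge_min lexx !orbT.
  by rewrite ltr_pdivrMr// ltr_pMr ?ltr1n.
have nt : `|t| = t by rewrite gtr0_norm.
have Mg : M (gam t) by apply: Hd'; rewrite -ball_normE /= sub0r normrN nt.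
have := Hd t; rewrite nt g0 add0r => /(_ td).
rewrite [t *: (1 : R)]mulr1; set h := _ - t *: u => hh.
have gxh : gam t - x = t *: u + h by rewrite [RHS]addrC subrK.
have kN : enorm (gam t - x) <= t * (N + e).
  by rewrite gxh (le_trans (enormD _ _))// enormZ nt mulrDr lerD// mulrC.
have gr : enorm (gam t - c) < r.
  by have := enorm_triangle (gam t) x c; lra.
have gg : g (gam t) = 0 by exact/(chart_mem Hch gr).
have := chart_taylor Hch xr gr; rewrite gx gg subrr sub0r enormN => H.
rewrite -(ler_pM2l t0) -{1}nt -enormZ scalemxAl.
have -> : t *: u = (gam t - x) - h by rewrite gxh addrK.
rewrite mulmxBl (le_trans (enormD _ _))// enormN mulrDl mulrDr addrC mul1r lerD//.
  rewrite (le_trans (Aa _))//; have := ler_wpM2l (ltW a0) hh; lra.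
rewrite (le_trans H)//.
apply: (@le_trans _ _ (C * (t * (N + e)) ^+ 2)).
  by rewrite ler_pM2l// lerXn2r ?nnegrE// mulr_ge0// ltW.
by rewrite exprMn expr2 -mulrA mulrCA ler_pM2l// mulrCA.
Qed.

(** Near [c] the matrix S = B A(x) is close to B A(c) = 1, hence invertible. Subtracting w B with w
    = v A(x) S^-1 moves v into the kernel of A(x), so to a tangent vector, and Qv is at least as
    close to v. *)
Lemma tangent_proj_defect x Q v : M x -> enorm (x - c) < s / 4 ->
  is_tangent_proj M x Q -> enorm (v - app Q v) <= 2 * b * enorm (v *m A x).
Proof.
move=> Mx xs MQ.
have xs' : enorm (x - c) < s by rewrite (lt_trans xs)// ltr_pdivrMr// ltr_pMr ?ltr1n.
have xr : enorm (x - c) < r by exact: lt_le_trans sr.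
have cr : enorm (c - c) < r by rewrite subrr enorm0 (chart_r_gt0 Hch).
pose S := B *m A x.
(* |w - w S| is at most |w| / 2; this yields both the injectivity of S and the factor 2 of the final
   bound. *)
have HS w : enorm w <= 2 * enorm (w *m S).
  have H := chart_lip Hch (w *m B) cr xr.
  rewrite -!mulmxA (chart_rinv Hch) mulmx1 -/S in H.
  have H2 : C * enorm (x - c) * enorm (w *m B) <= 2^-1 * enorm w.
    apply: (@le_trans _ _ (C * s * (b * enorm w))).
      by rewrite ler_pM// ?mulr_ge0 ?(ltW C0)// ler_pM2l// ltW.
    rewrite mulrA ler_wpM2r// (le_trans _ sb)//.
    have : 0 <= C * s * b by rewrite !mulr_ge0 ?(ltW C0)// ltW.
    lra.
  have := enorm_sub w (w *m S); rewrite enormB.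
  move: (le_trans H H2); lra.
have uS : S \in unitmx.
  rewrite -row_free_unit -kermx_eq0; apply/eqP/row_matrixP => i; rewrite row0.
  have : row i (kermx S) *m S = 0 by rewrite -row_mul mulmx_ker row0.
  move=> E; apply: enorm_eq0; apply/le_anti; rewrite enorm_ge0 andbT.
  by rewrite (le_trans (HS _))// E enorm0 mulr0.
pose w := v *m A x *m invmx S.
have wS : w *m S = v *m A x by rewrite /w mulmxKV.
have Tu : tangent_space M x (v - w *m B).
  apply: ker_tangent => //.
  by rewrite mulmxBl -mulmxA -/S wS subrr.
rewrite (le_trans (tangent_proj_closest v MQ Tu))// opprB addrC subrK.
rewrite (le_trans (Bb _))// -mulrA mulrCA ler_pM2l//.
by rewrite -wS.
Qed.

End ChartTheory.
End Chart.

(** * One step of the method *)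

Section NewtonStep.
Variable R : realType.

(** Chords: g vanishes at both ends, so Taylor bounds the defect. Normals: u = P(x) w lies in the
    kernel of A(x), so u A(z) = u (A(z) - A(x)) is small, and so is the part of u normal at z. Local
    closedness, from the continuity of g, will put the limit of the iterates in M. *)
Lemma manifold_geometry n (M : set 'rV[R]_n) P c :
  embedded_submanifold M -> (forall x, M x -> is_tangent_proj M x (P x)) -> M c ->
  exists K s : R, [/\ 0 < K, 0 < s,
    (forall x y, M x -> enorm (x - c) < s -> M y -> enorm (y - c) < s ->
       enorm ((y - x) - app (P x) (y - x)) <= K * enorm (y - x) ^+ 2),
    (forall x z w, M x -> enorm (x - c) < s -> M z -> enorm (z - c) < s ->
       (forall u, tangent_space M z u -> edot w u = 0) ->
       enorm (app (P x) w) <= K * enorm (x - z) * enorm w) &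
    (forall y, enorm (y - c) < s ->
       (forall e : R, 0 < e -> exists2 x, M x & enorm (x - y) < e) -> M y)].
Proof.
move=> HM HP Mc; have [p [g [A [B [C [r Hch]]]]]] := chart_exists HM Mc.
have C0 := chart_C_gt0 Hch; have r0 := chart_r_gt0 Hch.
have [b b0 Bb] := mulmx_bounded B.
pose s := Num.min r (6 * C * b)^-1.
have s0 : 0 < s by rewrite lt_min r0 invr_gt0 !mulr_gt0.
have sr : s <= r by rewrite ge_min lexx.
have sb : 3 * C * s * b <= 2^-1.
  have : s * (6 * C * b) <= 1.
    by rewrite -ler_pdivlMr ?mulr_gt0// div1r ge_min lexx orbT.
  lra.
have s4 : s / 4 < s by rewrite ltr_pdivrMr// ltr_pMr ?ltr1n.
have ball_r x : enorm (x - c) < s / 4 -> enorm (x - c) < r.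
  by move=> xs; rewrite (lt_le_trans _ sr)// (lt_trans xs).
have defect x v : M x -> enorm (x - c) < s / 4 ->
    enorm (v - app (P x) v) <= 2 * b * enorm (v *m A x).
  by move=> Mx xs; apply: (tangent_proj_defect Hch b0 Bb s0 sr sb) => //; exact: HP.
exists (2 * b * C), (s / 4); split; rewrite ?mulr_gt0 ?divr_gt0//.
- move=> x y Mx xs My ys; rewrite (le_trans (defect _ _ Mx xs))//.
  rewrite -(mulrA (2 * b)) ler_pM2l ?mulr_gt0//.
  have [xr yr] := (ball_r _ xs, ball_r _ ys).
  have := chart_taylor Hch xr yr.
  rewrite ((chart_mem Hch xr).1 Mx) ((chart_mem Hch yr).1 My).
  by rewrite subrr sub0r enormN.
- move=> x z w Mx xs Mz zs Tw.
  have [Tu orth] := HP x Mx w; set u := app (P x) w in Tu orth *.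
  have [->|u0] := eqVneq u 0; first by rewrite enorm0 !mulr_ge0// ltW.
  have uA := tangent_ker Hch Mx (ball_r _ xs) Tu.
  have [Tz _] := HP z Mz u.
  (* Here |u|^2 = <w, u>, and w is orthogonal to P(z) u. *)
  have E1 : enorm u ^+ 2 = edot w (u - app (P z) u).
    have := orth _ Tu; rewrite edotDl edotNl => /eqP; rewrite subr_eq0 => /eqP E.
    by rewrite enorm_sqr -E edotDr edotNr (Tw _ Tz) subr0.
  rewrite -(ler_pM2l (enorm_gt0 u0)) -expr2 E1 (le_trans (edot_le _ _))//.
  rewrite mulrC mulrA ler_wpM2r// (le_trans (defect _ _ Mz zs))//.
  have := chart_lip Hch u (ball_r _ xs) (ball_r _ zs).
  rewrite uA subr0 (enormB z) => H.
  have b2 : 0 <= 2 * b by rewrite mulr_ge0// ltW.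
  have := ler_wpM2l b2 H; lra.
- move=> y ys Hy; apply/(chart_mem Hch (ball_r _ ys))/enorm_eq0/le_anti.
  rewrite enorm_ge0 andbT.
  have [L L0 HL] := chart_lipschitz Hch s0 sr.
  apply: (ler_scaled_addgt0 L0) => e e0; rewrite add0r.
  have e1 : 0 < Num.min e (s / 4 - enorm (y - c)) by rewrite lt_min e0 subr_gt0.
  have [x Mx] := Hy _ e1; rewrite lt_min => /andP[xe xs].
  have xs4 : enorm (x - c) < s / 4 by have := enorm_triangle x y c; lra.
  have := HL _ _ (lt_trans xs4 s4) (lt_trans ys s4).
  rewrite ((chart_mem Hch (ball_r _ xs4)).1 Mx) subr0 => H.
  by rewrite (le_trans H)// ler_pM2l// enormB ltW.
Qed.

(** The error is the normal part of the chord z - x minus P(x) applied to x + d - z, a vector normal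
    at z. Since |x + d - z| <= |d| and |z - x| <= 2 |d|, these contribute 4 K and 2 K. *)
Lemma nearest_point_expansion n (M : set 'rV[R]_n) (P : 'rV[R]_n -> 'M[R]_n) c K s x d z :
  0 < K ->
  (forall x y, M x -> enorm (x - c) < s -> M y -> enorm (y - c) < s ->
     enorm ((y - x) - app (P x) (y - x)) <= K * enorm (y - x) ^+ 2) ->
  (forall x z w, M x -> enorm (x - c) < s -> M z -> enorm (z - c) < s ->
     (forall u, tangent_space M z u -> edot w u = 0) ->
     enorm (app (P x) w) <= K * enorm (x - z) * enorm w) ->
  M x -> enorm (x - c) < s -> enorm (z - c) < s -> nearest_point M (x + d) z ->
  enorm (z - x - app (P x) d) <= 6 * K * enorm d ^+ 2.
Proof.
move=> K0 G1 G2 Mx xs zs near; have [Mz zmin] := near.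
have zd : enorm (x + d - z) <= enorm d.
  by have := zmin _ Mx; rewrite [x + d - x]addrAC subrr add0r.
have zx : enorm (z - x) <= 2 * enorm d.
  have := enorm_triangle z (x + d) x.
  by rewrite [x + d - x]addrAC subrr add0r (enormB z (x + d)); lra.
have orth u : tangent_space M z u -> edot (x + d - z) u = 0.
  exact: nearest_point_orth.
have -> : z - x - app (P x) d =
    ((z - x) - app (P x) (z - x)) - app (P x) (x + d - z).
  have -> : x + d - z = d - (z - x) by apply/rowP => i; rewrite !mxE; ring.
  by rewrite [app _ (d - _)]mulmxBl opprB addrA subrK.
rewrite (le_trans (enormD _ _))// enormN.
have H1 := G1 _ _ Mx xs Mz zs; have H2 := G2 _ _ _ Mx xs Mz zs orth.
rewrite (le_trans (lerD H1 H2))// (enormB x z).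
have := enorm_ge0 d; have := enorm_ge0 (z - x); have := enorm_ge0 (x + d - z).
move: (enorm (z - x)) (enorm (x + d - z)) (enorm d) zx zd => a b e ae be b0 a0 e0.
have h1 : a ^+ 2 <= (2 * e) ^+ 2 by rewrite lerXn2r ?nnegrE ?mulr_ge0.
have h2 : a * b <= 2 * e * e by rewrite ler_pM.
have := ler_wpM2l (ltW K0) h1; have := ler_wpM2l (ltW K0) h2.
by rewrite !expr2; lra.
Qed.

(** * Bounds on B-Jacobians and the one-step estimate *)

Lemma enorm_app_le n (A : 'M[R]_n) (v : 'rV[R]_n) :
  enorm (app A v) <= n%:R * (n%:R * `|A|) * enorm v.
Proof.
apply: enorm_mulmx_rows => i; apply: enorm_le_coord => j; rewrite !mxE.
by rewrite [leRHS]/Num.Def.normr/= mx_normrE (le_bigmax _ _ (j, i)).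
Qed.

Lemma derive_lipschitz n (F : 'rV[R]_n -> 'rV[R]_n) (y v : 'rV[R]_n) L :
  (\forall z \near y, enorm (F z - F y) <= L * enorm (z - y)) ->
  derivable F y v -> enorm ('D_v F y) <= L * enorm v.
Proof.
move=> /nbhs_enorm[d d0 HL] Fv.
have /is_derive_enormP HD : is_derive y v F ('D_v F y) by exact: DeriveDef.
apply/ler_addgt0Pr => e e0; have [d' d'0 Hd'] := HD _ e0.
pose t := Num.min (d' / 2) (d / 2 / (enorm v + 1)).
have v1 : 0 < enorm v + 1 by rewrite ltr_wpDl.
have t0 : 0 < t by rewrite lt_min !divr_gt0.
have nt : `|t| = t by rewrite gtr0_norm.
have td' : `|t| < d'.
  rewrite nt (@le_lt_trans _ _ (d' / 2)) ?ge_min ?lexx//.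
  by rewrite ltr_pdivrMr// ltr_pMr ?ltr1n.
have td : t * enorm v < d.
  apply: (@le_lt_trans _ _ (t * (enorm v + 1))); first by rewrite ler_pM2l// lerDl.
  apply: (@le_lt_trans _ _ (d / 2)); first by rewrite -ler_pdivlMr// ge_min lexx orbT.
  by rewrite ltr_pdivrMr// ltr_pMr ?ltr1n.
have := HL (y + t *: v); rewrite [y + _]addrC addrK enormZ nt => /(_ td) H1.
have := Hd' t td'; rewrite [y + _]addrC nt => H2.
rewrite -(ler_pM2l t0) -{1}nt -enormZ.
rewrite (le_trans (enorm_sub _ (F (t *: v + y) - F y)))// (enormB (t *: _)).
by rewrite (le_trans (lerD H1 H2))// mulrDr mulrCA (mulrC e).
Qed.

(** The differentiability points tending to x end up inside the open ball, where the Lipschitz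
    constant bounds the Jacobian; the bound passes to the limit. *)
Lemma B_jacobian_bound n (F : 'rV[R]_n -> 'rV[R]_n) (c x : 'rV[R]_n) b L J v :
  (forall x y, cball c b x -> cball c b y ->
     enorm (F y - F x) <= L * enorm (y - x)) ->
  enorm (x - c) < b -> B_jacobian F x J -> enorm (app J v) <= L * enorm v.
Proof.
move=> HL xb [xs [xsx dF JF]].
pose K := n%:R * n%:R * enorm v + 1.
have K0 : 0 < K by rewrite ltr_wpDl// !mulr_ge0.
apply: (ler_scaled_addgt0 K0) => e e0.
have bx : 0 < b - enorm (x - c) by rewrite subr_gt0.
have near1 : \forall k \near \oo, `|J - jac F (xs k)| <= e.
  by move/cvgrPdist_le : JF; exact.
have near2 : \forall k \near \oo, enorm (xs k - x) < b - enorm (x - c).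
  exact: cvg_enorm_lt xsx bx.
have [k1 _ H1] := near1; have [k2 _ H2] := near2.
pose k := maxn k1 k2.
have Hk1 := H1 k (leq_maxl _ _); have Hk2 := H2 k (leq_maxr _ _).
set y := xs k in Hk1 Hk2.
have yb : enorm (y - c) < b by have := enorm_triangle y x c; lra.
have Hy : enorm (app (jac F y) v) <= L * enorm v.
  rewrite /app /jac trmxK -deriveEjacobian; last exact: dF.
  apply: derive_lipschitz; last exact/diff_derivable/dF.
  have by0 : 0 < b - enorm (y - c) by rewrite subr_gt0.
  have : \forall z \near y, enorm (z - y) < b - enorm (y - c).
    exact: (cvg_enorm_lt (@cvg_id _ (nbhs y)) by0).
  apply: filterS => z zy; apply: HL; rewrite /cball/= ltW//.
  have := enorm_triangle z y c; lra.
rewrite (le_trans (enorm_sub _ (app (jac F y) v)))// lerD//.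
have -> : app J v - app (jac F y) v = app (J - jac F y) v.
  by rewrite /app [(J - _)^T]linearB /= mulmxBr.
rewrite (le_trans (enorm_app_le _ _))//.
have nn0 : 0 <= n%:R * n%:R :> R by rewrite mulr_ge0.
rewrite /K mulrDl mul1r (mulrA n%:R) mulrAC.
apply: (@le_trans _ _ (n%:R * n%:R * enorm v * e)); first by rewrite ler_wpM2l// mulr_ge0.
by rewrite lerDl ltW.
Qed.

(** The infimum is only approached, hence the strict bound; its user pays with a factor 2. *)
Lemma edist_lt_exists n (x : 'rV[R]_n) (S : set 'rV[R]_n) (e : R) :
  (exists y, S y) -> Defs.edist x S < e -> exists2 y, S y & enorm (x - y) < e.
Proof.
move=> [y0 Sy0] Se.
have hinf : has_inf [set enorm (x - y) | y in S].
  split; first by exists (enorm (x - y0)), y0.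
  by exists 0 => _ [y _ <-].
have e0 : 0 < e - Defs.edist x S by rewrite subr_gt0.
have [_ [y Sy <-]] := inf_adherent e0 hinf.
by rewrite -/(Defs.edist x S) [X in _ < X]addrC subrK => ye; exists y.
Qed.

Lemma newton_step n (F : 'rV[R]_n -> 'rV[R]_n) (M : set 'rV[R]_n)
    (P : 'rV[R]_n -> 'M[R]_n) (q L3 : R) c :
  embedded_submanifold M -> (forall x, M x -> is_tangent_proj M x (P x)) ->
  1 < q -> 0 < L3 -> F c = 0 -> M c ->
  assumption_A1 F M c -> assumption_A2 F M P c -> assumption_A3 F M c ->
  exists K rho : R, [/\ 0 < K, 0 < rho &
    forall x x' d r J, M x -> enorm (x - c) < rho -> F x != 0 ->
      B_jacobian F x J ->
      app (J *m P x + (enorm (F x))%:M) d = - F x + r ->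
      enorm (r) / enorm (F x) <= L3 * enorm (F x) `^ q ->
      nearest_point M (x + d) x' ->
      [/\ M x', enorm (x' - x) <= K * enorm (F x) &
          enorm (F x') <= K * enorm (F x) ^+ 2]].
Proof.
move=> HM HP q1 L30 Fc Mc [b1 [L2 [L1 [b10 L20 L10 lipF A1]]]] [b2 [b20 A2]]
  [b3 [gam [b30 gam0 A3]]].
have [K1 [s [K10 s0 G1 G2 _]]] := manifold_geometry HM HP Mc.
(* By (A3) some solution lies within a mu of x; the 2 is the slack for an infimum that is only
   approached. *)
have [a a0 aE] : exists2 a : R, 0 < a & a = 2 / gam by exists (2 / gam); rewrite ?divr_gt0.
(* The four terms of [k1] bound the (A1) remainder, J applied to the normal part of the chord, the
   shift mu h and the residual r. *)
have [k1 k10 k1E] : exists2 k1, 0 < k1 & k1 = L1 * a ^+ 2 + L2 * K1 * a ^+ 2 + a + L3.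
  by eexists; last reflexivity; rewrite !(addr_gt0, mulr_gt0, exprn_gt0).
have [k2 k20 k2E] : exists2 k2, 0 < k2 & k2 = k1 + a.
  by exists (k1 + a); rewrite ?addr_gt0.
(* The first term bounds the step; the others bound F(x'): (A1) remainder, r, mu d, and J applied to
   the projection error. *)
pose K := 2 * k2 + (4 * L1 * k2 ^+ 2 + L3 + k2 + 6 * L2 * K1 * k2 ^+ 2).
(* Times |x - c|, the terms bound the distance of x to [c], the shifts to y and to x', and mu; so
   all points stay in the good ball and mu <= 1. *)
pose D := 1 + a * L2 + 2 * k2 * L2 + L2.
have [aL kL] : 0 < a * L2 /\ 0 < 2 * k2 * L2 by rewrite !mulr_gt0.
have D0 : 0 < D by rewrite !addr_gt0.
pose m := Num.min (Num.min b1 b2) (Num.min (Num.min b3 s) 1).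
have m0 : 0 < m by rewrite !lt_min b10 b20 b30 s0 ltr01.
exists K, (m / D); split; first by rewrite !(addr_gt0, mulr_gt0, exprn_gt0).
  exact: divr_gt0.
move=> x x' d r J Mx; rewrite ltr_pdivlMr// => xm Fx BJ Ad rmu near.
have [Mx' x'min] := near.
have mle : [/\ m <= b1, m <= b2, m <= b3, m <= s & m <= 1].
  by rewrite /m; split; rewrite !ge_min lexx ?orbT.
have [mb1 mb2 mb3 ms m1] := mle.
set mu := enorm (F x) in Ad rmu *; have mu0 : 0 < mu by exact: enorm_gt0.
have e0 : 0 <= enorm (x - c) by exact: enorm_ge0.
set e := enorm (x - c) in xm e0.
have [ae ke le'] : [/\ 0 <= a * L2 * e, 0 <= 2 * k2 * L2 * e & 0 <= L2 * e].
  by rewrite !mulr_ge0// ltW.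
have em : e + a * L2 * e + 2 * k2 * L2 * e + L2 * e < m.
  by move: xm; rewrite /D; lra.
have cc : cball c b1 c by rewrite /cball/= subrr enorm0 ltW.
have xb1 : cball c b1 x by rewrite /cball/= -/e; lra.
have muL : mu <= L2 * e.
  by have := lipF _ _ cc xb1; rewrite Fc subr0.
have mu1 : mu <= 1 by lra.
(* With mu <= 1 and q > 1, mu^q <= mu, so the residual is O(mu^2). *)
have rle : enorm r <= L3 * mu ^+ 2.
  move: rmu; rewrite ler_pdivrMr// => /le_trans; apply.
  rewrite expr2 mulrA ler_pM2r// ler_pM2l//.
  rewrite -[leRHS](powRr1 (ltW mu0)).
  by apply: ger_powR; rewrite ?mu0//= ltW.
have [y [Fy My] xy] : exists2 y, F y = 0 /\ M y & enorm (x - y) < a * mu.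
  apply: (@edist_lt_exists _ x [set y | F y = 0 /\ M y]); first by exists c.
  have := A3 x Mx; rewrite /cball/= -/e -/mu => /(_ _)H.
  have {}H : gam * Defs.edist x [set y | F y = 0 /\ M y] <= mu by apply: H; lra.
  have -> : a * mu = 2 * mu / gam by rewrite aE; field; rewrite gt_eqF.
  by rewrite ltr_pdivlMr// mulrC (le_lt_trans H)// ltr_pMl ?ltr1n.
set h := y - x.
have hmu : enorm h <= a * mu by rewrite enormB ltW.
have amu : a * mu <= a * L2 * e by rewrite -mulrA ler_pM2l.
have yc : enorm (y - c) < m by have := enorm_triangle y x c; rewrite -/h -/e; lra.
have yb1 : cball c b1 y by rewrite /cball/= ltW// (lt_le_trans yc).
have xs : enorm (x - c) < s by rewrite -/e; lra.
have ys : enorm (y - c) < s by exact: lt_le_trans ms.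
have xlt : enorm (x - c) < b1 by rewrite -/e; lra.
have Jb v : enorm (app J v) <= L2 * enorm v by exact: (B_jacobian_bound v lipF xlt BJ).
have xb2 : cball c b2 x by rewrite /cball/= -/e; lra.
have [uA Ainv] := A2 x J Mx xb2 Fx BJ.
have h2 : enorm h ^+ 2 <= a ^+ 2 * mu ^+ 2.
  by rewrite -exprMn lerXn2r ?nnegrE// mulr_ge0// ltW.
have appA v : app (J *m P x + mu%:M) v = app J (app (P x) v) + mu *: v.
  by rewrite /app linearD /= trmx_mul tr_scalar_mx mulmxDr mulmxA mul_mx_scalar.
have appB (Q : 'M[R]_n) u v : app Q (u - v) = app Q u - app Q v by exact: mulmxBl.
(* F(y) = 0 is inserted so that F(x) + J h becomes the (A1) remainder. *)
have Adh : enorm (app (J *m P x + mu%:M) (d - h)) <= k1 * mu ^+ 2.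
  have -> : app (J *m P x + mu%:M) (d - h) =
      (F y - F x - app J h) + app J (h - app (P x) h) - mu *: h + r.
    have alg (f r' u v w : 'rV[R]_n) : - f + r' - (u + w) = 0 - f - v + (v - u) - w + r'.
      by apply/rowP => i; rewrite !mxE; ring.
    rewrite (appB (_ + _)) Ad appA Fy (appB J h); exact: alg.
  have H1 := A1 _ _ _ Mx xb1 My yb1 BJ.
  have H2 := le_trans (Jb _) (ler_wpM2l (ltW L20) (G1 _ _ Mx xs My ys)).
  rewrite (le_trans (enormD _ _))// (le_trans (lerD (enormD _ _) rle))//.
  rewrite enormN enormZ (gtr0_norm mu0).
  have H3 := le_trans (enormD _ _) (lerD H1 H2).
  rewrite -/h in H3.
  have H4 : mu * enorm h <= mu * (a * mu) by rewrite ler_pM2l.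
  have H5 := ler_wpM2l (ltW L10) h2.
  have H6 := ler_wpM2l (ltW (mulr_gt0 L20 K10)) h2.
  rewrite (le_trans (lerD (lerD H3 H4) (lexx _)))//.
  by rewrite k1E; move: H5 H6; rewrite !expr2; lra.
(* The inverse costs a factor 1/mu by (A2), which leaves O(mu). *)
have dh : enorm (d - h) <= k1 * mu.
  have -> : d - h = app (invmx (J *m P x + mu%:M)) (app (J *m P x + mu%:M) (d - h)).
    by rewrite /app -mulmxA -trmx_mul mulVmx// trmx1 mulmx1.
  rewrite (le_trans (Ainv _))// -/mu mulrC ler_pdivrMr//.
  by rewrite (le_trans Adh)// expr2 mulrA.
have dmu : enorm d <= k2 * mu.
  by rewrite (le_trans (enorm_sub d h))// k2E mulrDl addrC lerD.
have xx' : enorm (x' - x) <= 2 * k2 * mu.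
  have H := x'min _ Mx; rewrite [x + d - x]addrAC subrr add0r in H.
  have := enorm_triangle x' (x + d) x; rewrite [x + d - x]addrAC subrr add0r.
  rewrite (enormB x' (x + d)); lra.
have kmu : 2 * k2 * mu <= 2 * k2 * L2 * e by rewrite -[leRHS]mulrA ler_pM2l// mulr_gt0.
have x'c : enorm (x' - c) < m by have := enorm_triangle x' x c; rewrite -/e; lra.
have x's : enorm (x' - c) < s by exact: lt_le_trans ms.
have x'b1 : cball c b1 x' by rewrite /cball/= ltW// (lt_le_trans x'c).
have musq : 0 <= mu ^+ 2 by rewrite exprn_ge0// ltW.
split=> //.
  rewrite (le_trans xx')// ler_pM2r// lerDl.
  by rewrite ltW// !(addr_gt0, mulr_gt0, exprn_gt0).
set w := x' - x - app (P x) d.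
have wle : enorm w <= 6 * K1 * enorm d ^+ 2.
  exact: (nearest_point_expansion K10 G1 G2 Mx xs x's near).
(* J P d + F(x) = r - mu d, so the linear part of F(x') is O(mu^2). *)
have -> : F x' = (F x' - F x - app J (x' - x)) + (r - mu *: d) + app J w.
  have alg (f f' r' u v z : 'rV[R]_n) : u + z = - f + r' ->
      f' = (f' - f - v) + (r' - z) + (v - u).
    by move=> /rowP E; apply/rowP => i; have := E i; rewrite !mxE; lra.
  by rewrite /w (appB J (x' - x)); apply: alg; rewrite -appA.
have d2 : enorm d ^+ 2 <= k2 ^+ 2 * mu ^+ 2.
  by rewrite -exprMn lerXn2r ?nnegrE// mulr_ge0// ltW.
have xx'2 : enorm (x' - x) ^+ 2 <= (2 * k2 * mu) ^+ 2.
  by rewrite lerXn2r ?nnegrE// !mulr_ge0// ltW.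
have H1 := le_trans (A1 _ _ _ Mx xb1 Mx' x'b1 BJ) (ler_wpM2l (ltW L10) xx'2).
have H2 : enorm (r - mu *: d) <= L3 * mu ^+ 2 + mu * (k2 * mu).
  rewrite (le_trans (enormD _ _))// enormN enormZ (gtr0_norm mu0) lerD//.
  by rewrite ler_pM2l.
have K16 : 0 <= 6 * K1 by rewrite mulr_ge0// ltW.
have H3 := le_trans (Jb w) (ler_wpM2l (ltW L20) (le_trans wle (ler_wpM2l K16 d2))).
rewrite (le_trans (enormD _ _))// (le_trans (lerD (enormD _ _) H3))//.
rewrite (le_trans (lerD (lerD H1 H2) (lexx _)))//.
have : 0 <= k2 * mu ^+ 2 by rewrite mulr_ge0// ltW.
by rewrite /K !expr2; lra.
Qed.

End NewtonStep.

(** * Convergence *)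

Theorem theorem5p4 (R : realType) (n : nat)
    (F : 'rV[R]_n -> 'rV[R]_n) (M : set 'rV[R]_n)
    (P : 'rV[R]_n -> 'M[R]_n) (q L3 : R) (xstar : 'rV[R]_n) :
  locally_lipschitz F ->
  embedded_submanifold M ->
  (forall x, M x -> is_tangent_proj M x (P x)) ->
  1 < q -> q <= 2 -> 0 < L3 ->
  (F xstar = 0 /\ M xstar) ->
  assumption_A1 F M xstar ->
  assumption_A2 F M P xstar ->
  assumption_A3 F M xstar ->
  exists delta : R, 0 < delta /\
  forall (x0 : 'rV[R]_n) (x d r : nat -> 'rV[R]_n) (J : nat -> 'M[R]_n),
    M x0 ->
    (* xstar is a point of X~* nearest to x0, and x0 is close to X~* *)
    nearest_point [set y | F y = 0 /\ M y] x0 xstar ->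
    enorm (x0 - xstar) < delta ->
    x 0%N = x0 ->
    (forall k, enorm (F (x k)) != 0 ->
       let mu := enorm (F (x k)) in
       [/\ B_jacobian F (x k) (J k),
           app (J k *m P (x k) + mu%:M) (d k) = - F (x k) + r k,
           enorm (r k) / mu <= L3 * mu `^ q &
           nearest_point M (x k + d k) (x k.+1)]) ->
    (* the method stops (stays put) once an exact zero is reached *)
    (forall k, enorm (F (x k)) = 0 -> x k.+1 = x k) ->
    exists xhat : 'rV[R]_n,
      [/\ F xhat = 0, M xhat,
          (forall e : R, 0 < e -> exists K : nat, forall k, (K <= k)%N ->
             enorm (x k - xhat) < e) &
          (forall e : R, 0 < e -> exists K : nat, forall k, (K <= k)%N ->
             enorm (x k.+1 - xhat) <= e * enorm (x k - xhat))].
Proof.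
move=> _ HM HP q1 _ L30 [Fc Mc] A1 A2 A3.
have [K [rho [K0 rho0 step]]] := newton_step HM HP q1 L30 Fc Mc A1 A2 A3.
have [b1 [L [_ [b10 L0 _ lipF _]]]] := A1.
have [_ [s [_ s0 _ _ Mclosed]]] := manifold_geometry HM HP Mc.
pose m := Num.min (Num.min rho 1) (Num.min b1 s).
have m0 : 0 < m by rewrite !lt_min rho0 ltr01 b10.
have [mrho m1 mb ms] : [/\ m <= rho, m <= 1, m <= b1 & m <= s].
  by rewrite /m; split; rewrite !ge_min lexx ?orbT.
have KL0 : 0 < K * L by rewrite mulr_gt0.
(* The steps add up to at most 2 K mu_0 <= 2 K L e, so the iterates and their limit stay within m of
   [xstar]. Also K mu_0 <= 1/4, so K mu_k^2 <= mu_k / 2. *)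
exists (m / (1 + 4 * (K * L))); split; first by rewrite divr_gt0// addr_gt0// mulr_gt0.
move=> x0 x d r J Mx0 _; rewrite ltr_pdivlMr; last by rewrite addr_gt0// mulr_gt0.
move=> x0m x0E iter stop.
set e := enorm (x0 - xstar) in x0m; have e0 : 0 <= e by exact: enorm_ge0.
have KLe : 0 <= K * L * e by rewrite mulr_ge0// ltW.
pose mu k := enorm (F (x k)); have mu_ge0 k : 0 <= mu k by exact: enorm_ge0.
have inb y : enorm (y - xstar) < m -> cball xstar b1 y.
  by move=> ym; rewrite /cball/= ltW// (lt_le_trans ym).
have xsb : cball xstar b1 xstar by rewrite /cball/= subrr enorm0 ltW.
have mu0L : mu 0%N <= L * e.
  rewrite /mu x0E; have x0b : cball xstar b1 x0 by apply: inb; rewrite -/e; lra.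
  by have := lipF _ _ xsb x0b; rewrite Fc subr0.
have Kmu0 : K * mu 0%N <= K * L * e by rewrite -mulrA ler_pM2l.
have half_ge0 k : 0 <= 2^-1 ^+ k :> R by rewrite exprn_ge0.
have inv k : [/\ M (x k), mu k <= mu 0%N * 2^-1 ^+ k &
    enorm (x k - x0) <= 2 * (K * mu 0%N) * (1 - 2^-1 ^+ k)] /\
    [/\ enorm (x k.+1 - x k) <= K * mu k, mu k.+1 <= K * mu k ^+ 2 & mu k.+1 <= mu k / 2].
  have progress j : M (x j) -> mu j <= mu 0%N * 2^-1 ^+ j ->
      enorm (x j - x0) <= 2 * (K * mu 0%N) * (1 - 2^-1 ^+ j) ->
      [/\ M (x j.+1), enorm (x j.+1 - x j) <= K * mu j, mu j.+1 <= K * mu j ^+ 2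
        & mu j.+1 <= mu j / 2].
    (* After an exact zero the iterate stays put and all bounds hold trivially. *)
    move=> Mx muj xj; have [Fxj|Fxj] := eqVneq (mu j) 0.
      rewrite /mu stop// -/(mu j) Fxj expr0n mul0r mulr0 subrr enorm0.
      by split.
    have [BJ Ad rmu near] := iter j Fxj.
    have Fx : F (x j) != 0 by apply: contraNneq Fxj => E; rewrite /mu E enorm0.
    have xr : enorm (x j - xstar) < rho.
      have := enorm_triangle (x j) x0 xstar; rewrite -/e.
      have : 2 * (K * mu 0%N) * (1 - 2^-1 ^+ j) <= 2 * (K * mu 0%N).
        by rewrite ler_piMr ?gerBl// !mulr_ge0// ltW.
      by move: x0m xj; lra.
    have [Mx' xx' mu'] := step _ _ _ _ _ Mx xr Fx BJ Ad rmu near.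
    split=> //; rewrite (le_trans mu')// -/(mu j) expr2 mulrA mulrC ler_wpM2l//.
    have : K * mu j <= K * mu 0%N.
      by rewrite ler_pM2l// (le_trans muj)// ler_piMr// exprn_ile1// invf_le1 ?ler1n.
    by move: x0m; lra.
  have base : [/\ M (x k), mu k <= mu 0%N * 2^-1 ^+ k &
      enorm (x k - x0) <= 2 * (K * mu 0%N) * (1 - 2^-1 ^+ k)].
    elim: k => [|k [IH1 IH2 IH3]].
      by split; rewrite ?x0E ?expr0 ?mulr1// !subrr mulr0 enorm0.
    have [Mx' xx' _ mu'] := progress k IH1 IH2 IH3; split=> //.
      by rewrite exprSr mulrA (le_trans mu')// ler_wpM2r.
    rewrite (le_trans (enorm_triangle _ (x k) _))// (le_trans (lerD xx' IH3))//.
    have := ler_wpM2l (ltW K0) IH2; rewrite exprS; lra.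
  by split=> //; have [? ? ?] := base; have [] := progress k.
have xstep k : enorm (x k.+1 - x k) <= K * mu 0%N * 2^-1 ^+ k.
  have [[_ muk _] [xk _ _]] := inv k.
  by rewrite (le_trans xk)// -mulrA ler_pM2l.
have Kmu_ge0 k : 0 <= K * mu k by rewrite mulr_ge0// ltW.
have [xhat Hx] := geometric_cvg (Kmu_ge0 0%N) xstep.
have xcvg (t : R) : 0 < t -> exists k0, forall k, (k0 <= k)%N -> enorm (x k - xhat) < t.
  move=> t0; have c0 : 0 <= 2 * (K * mu 0%N) by rewrite mulr_ge0.
  have [k0 Hk0] := geometric_small c0 t0.
  by exists k0 => k /Hk0; exact: le_lt_trans.
(* Restarting the geometric estimate at step k bounds the tail by mu_k itself. *)
have tail k : enorm (x k - xhat) <= 2 * (K * mu k).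
  have muS j : mu (k + j)%N <= mu k * 2^-1 ^+ j.
    elim: j => [|j IH]; first by rewrite addn0 expr0 mulr1.
    have [_ [_ _ muj]] := inv (k + j)%N.
    by rewrite addnS exprSr mulrA (le_trans muj)// ler_wpM2r.
  have stepS j : enorm (x (k + j.+1)%N - x (k + j)%N) <= K * mu k * 2^-1 ^+ j.
    have [_ [xj _ _]] := inv (k + j)%N.
    by rewrite addnS (le_trans xj)// -mulrA ler_pM2l.
  apply/ler_addgt0Pr => t t0; have [j0 /(_ (k + j0)%N (leq_addl _ _)) Hj] := xcvg t t0.
  rewrite (le_trans (enorm_triangle _ (x (k + j0)%N) _))// lerD ?(ltW Hj)// enormB.
  have := @geometric_sum_le R n (fun j => x (k + j)%N) _ 0 j0 (Kmu_ge0 k) stepS.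
  by rewrite add0n addn0 expr0 mulr1.
have ball_m k : enorm (x k - xstar) < m.
  have [[_ _ xk] _] := inv k.
  have := enorm_triangle (x k) x0 xstar; rewrite -/e.
  have : 2 * (K * mu 0%N) * (1 - 2^-1 ^+ k) <= 2 * (K * mu 0%N).
    by rewrite ler_piMr ?gerBl// mulr_ge0.
  by move: x0m xk; lra.
have xhat_m : enorm (xhat - xstar) < m.
  have := tail 0%N; rewrite x0E enormB => H0.
  by have := enorm_triangle xhat x0 xstar; rewrite -/e; move: x0m; lra.
(* |F(xhat)| <= mu_k + L |x_k - xhat|, and both terms decay geometrically. *)
have Fxhat : F xhat = 0.
  apply: enorm_eq0; apply/le_anti; rewrite enorm_ge0 andbT.
  apply/ler_addgt0Pr => t t0; rewrite add0r.
  have c0 : 0 <= mu 0%N + L * (2 * (K * mu 0%N)).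
    by rewrite addr_ge0// !mulr_ge0// ltW.
  have [k /(_ k (leqnn _)) Hk] := geometric_small c0 t0.
  have [[_ muk _] _] := inv k.
  rewrite (le_trans _ (ltW Hk))// (le_trans (enorm_sub _ (F (x k))))// mulrDl lerD//.
  rewrite (le_trans (lipF _ _ (inb _ (ball_m k)) (inb _ xhat_m)))//.
  by rewrite -[leRHS]mulrA ler_pM2l// enormB.
exists xhat; split=> //.
- apply: Mclosed => [|t /xcvg[k /(_ k (leqnn _)) xk]]; first exact: lt_le_trans ms.
  by exists (x k) => //; have [[]] := inv k.
- move=> t t0.
  (* The chain is |x_{k+1} - xhat| <= 2 K mu_{k+1} <= 2 K^2 mu_k^2 <= (2 K^2 L mu_k) |x_k - xhat|,
     whose factor tends to 0. *)
  have c0 : 0 <= 2 * K ^+ 2 * L * mu 0%N by rewrite !mulr_ge0 ?exprn_ge0// ltW.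
  have [k0 Hk0] := geometric_small c0 t0; exists k0 => k /Hk0 /ltW Hk.
  have [[_ muk _] [_ mu' _]] := inv k.
  have muL : mu k <= L * enorm (x k - xhat).
    by have := lipF _ _ (inb _ xhat_m) (inb _ (ball_m k)); rewrite Fxhat subr0.
  rewrite (le_trans (tail k.+1))//.
  apply: (@le_trans _ _ (2 * K ^+ 2 * mu k * (L * enorm (x k - xhat)))).
    rewrite (le_trans _ (ler_wpM2l _ muL))//; last by rewrite !mulr_ge0 ?exprn_ge0// ltW.
    have := ler_wpM2l (ltW K0) mu'; rewrite !expr2; lra.
  rewrite mulrA ler_wpM2r// (le_trans _ Hk)//.
  have k2L : 0 <= 2 * K ^+ 2 * L by rewrite !mulr_ge0 ?exprn_ge0// ltW.
  by have := ler_wpM2l k2L muk; lra.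
Qed.
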